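(* Let $n\ge 1$ be an integer. The following four assertions are all true, and they are equivalent to one another. (i) For every smooth function $f:\mathbf{R}^n\to\mathbf{R}^+$ such that $f$ and $|\nabla f|$ are $\gamma_n$-integrable, $$\left|\mathbf{E}_{\gamma_n}(\nabla f)\right|^2\le 2\,\mathbf{Ent}_{\gamma_n}(f)\,\mathbf{E}_{\gamma_n}(f).$$ (ii) For every smooth probability density function $g:\mathbf{R}^n\to\mathbf{R}^+$ (with respect to Lebesgue measure) with finite second moments, $$-\mathbf{Ent}_{\lambda_n}(g)\le \frac n2\log\left[\frac{2\pi e}{n}\,\mathrm{Tr}\,\mathbf{K}(g)\right].$$ (iii) For every random vector $X$ in $\mathbf{R}^n$ with a smooth probability density function and finite second moments, $$n\,\mathbf{N}(X)\le \mathrm{Tr}\,\mathbf{K}(X).$$ (iv) For every random vector $X$ in $\mathbf{R}^n$ with a smooth probability density function and finite second moments, $$\mathbf{N}(X)\le |\mathbf{K}(X)|^{1/n}.$$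
   Context: Notation. $\mathbf{R}^+=[0,\infty)$; $\lambda_n$ (also written $dx$) is Lebesgue measure on $\mathbf{R}^n$; $\gamma_n$ is the standard Gaussian measure on $\mathbf{R}^n$, $d\gamma_n(x)=(2\pi)^{-n/2}e^{-|x|^2/2}\,dx$, where $|\cdot|$ is the Euclidean norm on vectors; $\mathbf{E}_{\gamma_n}$ denotes integration with respect to $\gamma_n$ (componentwise for vector-valued functions). For a positive measure $\mu$ and a non-negative $\mu$-integrable function $f$, the entropy is $$\mathbf{Ent}_\mu(f):=\int f\log f\,d\mu-\int f\,d\mu\,\log\int f\,d\mu,$$ with the convention $0\log 0=0$. In the situations considered the first integral is well defined as an extended real number: for $\mu=\gamma_n$ one has $\mathbf{Ent}_{\gamma_n}(f)\in[0,+\infty]$; for $\mu=\lambda_n$ and a probability density $g$ with finite second moments, $\mathbf{Ent}_{\lambda_n}(g)=\int g\log g\,dx\in(-\infty,+\infty]$. In (i), if $f$ is identically zero, both sides are read as $0$. $\mathbf{K}(g)$ is the covariance matrix of the probability density $g$, and $\mathbf{K}(X)$ is the covariance matrix of the random vector $X$; for a matrix $\mathbf{K}$, $\mathrm{Tr}\,\mathbf{K}$ is its trace and $|\mathbf{K}|$ its determinant. For a random vector $X$ in $\mathbf{R}^n$ with probability density $f$, the Shannon entropy is $\mathbf{H}(X):=-\mathbf{Ent}_{\lambda_n}(f)=-\int f\log f\,dx$, and the Shannon entropy power is $$\mathbf{N}(X):=\frac{1}{2\pi e}\exp\left(\frac2n\,\mathbf{H}(X)\right),$$ with $\mathbf{N}(X)=0$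 if $\mathbf{H}(X)=-\infty$. *)

(* Defs.v *)
From HB Require Import structures.
From mathcomp Require Import all_boot all_order all_algebra.
From mathcomp Require Import all_classical all_reals all_analysis.
From mathcomp Require Import measurable_realfun.

Set Implicit Arguments.
Unset Strict Implicit.
Unset Printing Implicit Defensive.
Import Order.TTheory GRing.Theory Num.Theory.
Import numFieldNormedType.Exports.

Local Open Scope classical_set_scope.
Local Open Scope ring_scope.

(* R^n is the type 'rV[R]_n, whose library topology is the usual one; its
   Borel sigma-algebra is generated by the coordinates, as the library does for
   tuples. *)
Definition measure_rV_display : measure_display -> measure_display.
Proof. exact. Qed.

Section measurable_rV.
Context {d : measure_display} {T : sigmaRingType d}.
Variable n : nat.

Let coors : 'I_n -> 'rV[T]_n -> T := fun i x => x ord0 i.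

Let rV_set0 : g_sigma_preimage coors set0.
Proof. exact: sigma_algebra0. Qed.

Let rV_setC A : g_sigma_preimage coors A -> g_sigma_preimage coors (~` A).
Proof. exact: sigma_algebraC. Qed.

Let rV_bigcup (F : _^nat) : (forall i, g_sigma_preimage coors (F i)) ->
  g_sigma_preimage coors (\bigcup_i (F i)).
Proof. exact: sigma_algebra_bigcup. Qed.

HB.instance Definition _ := @isMeasurable.Build (measure_rV_display d)
  'rV[T]_n (g_sigma_preimage coors) rV_set0 rV_setC rV_bigcup.

End measurable_rV.

Lemma measurable_coord (d : measure_display) (T : sigmaRingType d) n (i : 'I_n) :
  measurable_fun [set: 'rV[T]_n] (fun x => x ord0 i).
Proof.
move=> _ Y mY; rewrite setTI; apply: sub_sigma_algebra => /=.
rewrite -bigcup_seq/=; exists i => /=; first by rewrite mem_index_enum.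
by exists Y => //; rewrite setTI.
Qed.

Lemma measurable_fun_rVP (d1 d2 : measure_display) (T1 : measurableType d1)
    (T2 : measurableType d2) n (f : T1 -> 'rV[T2]_n) :
  (forall i, measurable_fun [set: T1] (fun x => f x ord0 i)) ->
  measurable_fun [set: T1] f.
Proof.
move=> mf _ A mA.
suff : preimage_set_system [set: T1] f
    (g_sigma_preimage (fun (i : 'I_n) (x : 'rV[T2]_n) => x ord0 i)) `<=`
    measurable.
  by apply; exists A.
rewrite -g_sigma_preimage_comp.
apply: smallest_sub; first exact: sigma_algebra_measurable.
case: n => [|n] in f mf A mA *; first by rewrite big_ord0.
rewrite -bigcup_mkord_ord; apply: bigcup_sub => i Ii.
by move=> B [C mC <-]; exact: mf.
Qed.

Section lebesgue_rV.
Context {R : realType}.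

Definition cons_rV n (p : measurableTypeR R * 'rV[R]_n) : 'rV[R]_n.+1 :=
  row_mx (p.1 : R)%:M p.2.

Lemma measurable_cons_rV n : measurable_fun setT (@cons_rV n).
Proof.
apply: measurable_fun_rVP => i; rewrite /cons_rV.
case: (splitP (i : 'I_(1 + n))) => [j ij|j ij].
- have -> : i = lshift n j by apply/val_inj.
  rewrite (_ : (fun _ => _) = fst); last first.
    apply/funext => x; apply: (etrans (row_mxEl _ _ _ _)).
    by rewrite (ord1 j) mxE eqxx mulr1n.
  exact: measurable_fst.
- have -> : i = rshift 1 j by apply/val_inj.
  rewrite (_ : (fun _ => _) = (fun v : 'rV[R]_n => v ord0 j) \o snd); last first.
    by apply/funext => x; exact: row_mxEr.
  by apply: measurableT_comp; [exact: measurable_coord|exact: measurable_snd].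
Qed.

Definition uncons_rV n (v : 'rV[R]_n.+1) : measurableTypeR R * 'rV[R]_n :=
  (v ord0 ord0, rsubmx (v : 'rV[R]_(1 + n))).

Lemma uncons_rVK n : cancel (@uncons_rV n) (@cons_rV n).
Proof.
move=> v; apply: etrans (hsubmxK (v : 'rV_(1 + n))).
rewrite /cons_rV/=; congr (row_mx _ _).
apply/rowP => i; rewrite (ord1 i) !mxE eqxx mulr1n /=; congr (v _ _).
exact/val_inj.
Qed.

Lemma cons_rVK n : cancel (@cons_rV n) (@uncons_rV n).
Proof.
move=> [x v]; rewrite /uncons_rV /cons_rV row_mxKr; congr (_, _).
have -> : (ord0 : 'I_n.+1) = lshift n (ord0 : 'I_1) by exact/val_inj.
by apply: (etrans (row_mxEl _ _ _ _)); rewrite mxE eqxx mulr1n.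
Qed.

Lemma measurable_uncons_rV n : measurable_fun setT (@uncons_rV n).
Proof.
apply: measurable_fun_pair; first exact: measurable_coord.
apply: measurable_fun_rVP => i; rewrite (_ : (fun _ => _) =
    (fun v : 'rV[R]_n.+1 => v ord0 (rshift 1 i))); last first.
  by apply/funext => v; rewrite mxE.
exact: measurable_coord.
Qed.

(* Lebesgue measure on R^n: the n-fold product of Lebesgue measure on R,
   transported along R * R^n = R^(n + 1) *)
Fixpoint lebesgue_rV (n : nat) : set 'rV[R]_n -> \bar R :=
  match n with
  | 0%N => @dirac _ 'rV[R]_0 0 R
  | m.+1 => pushforward (lebesgue_measure \x @lebesgue_rV m)%E (@cons_rV m)
  end.

Lemma sigma_finite_measureP (d : measure_display) (T : measurableType d)
    (p : set T -> \bar R) :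
  p set0 = 0%E -> (forall A, (0 <= p A)%E) -> semi_sigma_additive p ->
  sigma_finite setT p ->
  exists m : {sigma_finite_measure set T -> \bar R},
    m = p :> (set T -> \bar R).
Proof.
move=> p0 p_ge0 p_add p_fin.
pose M := isMeasure.Build _ _ _ p p0 p_ge0 p_add.
pose pM : {measure set T -> \bar R} := HB.pack p M.
pose S := Measure_isSigmaFinite.Build _ _ _ pM p_fin.
pose pS : {sigma_finite_measure set T -> \bar R} := HB.pack p pM S.
by exists pS.
Qed.

Lemma lebesgue_rV_sigma_finite_measure n :
  exists m : {sigma_finite_measure set 'rV[R]_n -> \bar R},
    m = @lebesgue_rV n :> (set 'rV[R]_n -> \bar R).
Proof.
elim: n => [|n [m mE]] /=; first by exists (@dirac _ 'rV[R]_0 0 R).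
rewrite -mE.
pose p := pushforward (lebesgue_measure \x m)%E (@cons_rV n).
have p0 : p set0 = 0%E by rewrite /p /pushforward preimage_set0 measure0.
have p_ge0 A : (0 <= p A)%E by rewrite /p /pushforward; exact: measure_ge0.
have mpre A : measurable A -> measurable (@cons_rV n @^-1` A).
  by move=> mA; rewrite -[X in measurable X]setTI; exact: measurable_cons_rV.
have p_add : semi_sigma_additive p.
  move=> F mF tF mUF; rewrite /p /pushforward preimage_bigcup.
  apply: measure_semi_sigma_additive.
  - by move=> k; exact: mpre.
  - apply/trivIsetP => /= i j _ _ ij; rewrite -preimage_setI.
    by move/trivIsetP : tF => /(_ _ _ _ _ ij) ->//; rewrite preimage_set0.
  - by rewrite -preimage_bigcup; exact: mpre.
have p_fin : sigma_finite setT p.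
  have /sigma_finiteP[F [TF ndF Ffin]] := sigma_finiteT (@lebesgue_measure R).
  have /sigma_finiteP[G [TG ndG Gfin]] := sigma_finiteT m.
  exists (fun k => @uncons_rV n @^-1` (F k `*` G k)).
    apply/seteqP; split=> // v _.
    have : (\bigcup_k F k) (uncons_rV v).1 by rewrite -TF.
    have : (\bigcup_k G k) (uncons_rV v).2 by rewrite -TG.
    move=> [k _ Gk] [l _ Fl]; exists (maxn k l) => //; split.
    - by move: Fl; apply/subsetPset/ndF/leq_maxr.
    - by move: Gk; apply/subsetPset/ndG/leq_maxl.
  move=> k; have [mF Foo] := Ffin k; have [mG Goo] := Gfin k; split.
    rewrite -[X in measurable X]setTI; apply: measurable_uncons_rV => //.
    exact: measurableX.
  rewrite /p /pushforward (_ : _ @^-1` _ = F k `*` G k).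
    by rewrite product_measure1E// lte_mul_pinfty// ge0_fin_numE.
  by rewrite -comp_preimage (_ : _ \o _ = id)//; apply/funext; exact: cons_rVK.
exact: (sigma_finite_measureP p0 p_ge0 p_add p_fin).
Qed.

Section lebesgue_rV_instances.
Variable n : nat.

Let lebesgue_rV0 : @lebesgue_rV n set0 = 0%E.
Proof.
by have [m <-] := lebesgue_rV_sigma_finite_measure n; rewrite measure0.
Qed.

Let lebesgue_rV_ge0 A : (0 <= @lebesgue_rV n A)%E.
Proof.
by have [m <-] := lebesgue_rV_sigma_finite_measure n; exact: measure_ge0.
Qed.

Let lebesgue_rV_sigma_additive : semi_sigma_additive (@lebesgue_rV n).
Proof.
have [m <-] := lebesgue_rV_sigma_finite_measure n.
exact: measure_semi_sigma_additive.
Qed.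

HB.instance Definition _ := isMeasure.Build _ _ _ (@lebesgue_rV n)
  lebesgue_rV0 lebesgue_rV_ge0 lebesgue_rV_sigma_additive.

Let lebesgue_rV_sigma_finite : sigma_finite setT (@lebesgue_rV n).
Proof.
have [m <-] := lebesgue_rV_sigma_finite_measure n; exact: sigma_finiteT.
Qed.

HB.instance Definition _ := Measure_isSigmaFinite.Build _ _ _ (@lebesgue_rV n)
  lebesgue_rV_sigma_finite.

End lebesgue_rV_instances.

End lebesgue_rV.
Arguments lebesgue_rV {R} n.

Section gauss_rV.
Context {R : realType}.

(* the Euclidean norm; `|x| on 'rV[R]_n is the sup norm *)
Definition enorm n (x : 'rV[R]_n) : R := Num.sqrt (\sum_(i < n) x ord0 i ^+ 2).

Definition gauss_pdf_rV n (x : 'rV[R]_n) : R :=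
  (2 * pi) `^ (- (n%:R / 2)) * expR (- (enorm x ^+ 2 / 2)).

Lemma gauss_pdf_rV_ge0 n (x : 'rV[R]_n) : 0 <= gauss_pdf_rV x.
Proof. by rewrite mulr_ge0 ?powR_ge0 ?expR_ge0. Qed.

Lemma measurable_gauss_pdf_rV n : measurable_fun setT (@gauss_pdf_rV n).
Proof.
apply: measurable_funM => //; apply: measurableT_comp => //.
apply: measurableT_comp => //; apply: measurable_funM => //.
rewrite (_ : (fun _ => _) = fun x : 'rV[R]_n => \sum_(i < n) x ord0 i ^+ 2).
  by apply: measurable_sum => i; apply: measurable_funX; exact: measurable_coord.
by apply/funext => x; rewrite sqr_sqrtr// sumr_ge0// => i _; rewrite sqr_ge0.
Qed.

Definition gauss_rV (n : nat) (A : set 'rV[R]_n) : \bar R :=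
  (\int[lebesgue_rV n]_(x in A) (gauss_pdf_rV x)%:E)%E.

Section gauss_rV_instances.
Variable n : nat.

Let gauss_rV0 : @gauss_rV n set0 = 0%E.
Proof. by rewrite /gauss_rV integral_set0. Qed.

Let gauss_rV_ge0 A : (0 <= @gauss_rV n A)%E.
Proof. by apply: integral_ge0 => x _; rewrite lee_fin gauss_pdf_rV_ge0. Qed.

Let gauss_rV_sigma_additive : semi_sigma_additive (@gauss_rV n).
Proof.
move=> F mF tF mUF; rewrite /gauss_rV ge0_integral_bigcup//=.
- apply: is_cvg_ereal_nneg_natsum_cond => k _ _.
  by apply: integral_ge0 => x _; rewrite lee_fin gauss_pdf_rV_ge0.
- by apply/measurable_EFinP/measurable_funTS; exact: measurable_gauss_pdf_rV.
- by move=> x _; rewrite lee_fin gauss_pdf_rV_ge0.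
Qed.

HB.instance Definition _ := isMeasure.Build _ _ _ (@gauss_rV n)
  gauss_rV0 gauss_rV_ge0 gauss_rV_sigma_additive.

End gauss_rV_instances.

End gauss_rV.
Arguments gauss_rV {R} n.

Section smooth.
Context {R : realType} {n : nat}.
Implicit Type f : 'rV[R]_n -> R.

Definition partial (i : 'I_n) f : 'rV[R]_n -> R := 'D_(delta_mx ord0 i) f.

Definition gradient f (x : 'rV[R]_n) : 'rV[R]_n := \row_i partial i f x.

(* C^oo: all iterated partial derivatives, of every order, exist everywhere
   and are continuous *)
Definition smooth f : Prop := forall s : seq 'I_n,
  continuous (foldr partial f s) /\
  forall (i : 'I_n) (x : 'rV[R]_n),
    derivable (foldr partial f s) x (delta_mx ord0 i).

End smooth.

(* ln 0 = 0, so the convention 0 log 0 = 0 holds *)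
Definition Ent (d : measure_display) (T : measurableType d) (R : realType)
    (mu : {measure set T -> \bar R}) (f : T -> R) : \bar R :=
  let m := (\int[mu]_x f x)%R in
  (\int[mu]_x (f x * ln (f x))%:E - (m * ln m)%:E)%E.

Section densities.
Context {R : realType} {n : nat}.
Implicit Types g : 'rV[R]_n -> R.

Definition is_pdf g : Prop :=
  [/\ measurable_fun setT g, (forall x, 0 <= g x) &
      (\int[lebesgue_rV n]_x (g x)%:E = 1)%E].

Definition pdf_finite_second_moments g : Prop := forall i : 'I_n,
  (lebesgue_rV n).-integrable setT (fun x => (x ord0 i ^+ 2 * g x)%:E).

Definition pdf_mean g : 'rV[R]_n :=
  \row_i (\int[lebesgue_rV n]_x (x ord0 i * g x))%R.

Definition pdf_cov g : 'M[R]_n := \matrix_(i, j)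
  (\int[lebesgue_rV n]_x
     ((x ord0 i - pdf_mean g ord0 i) * (x ord0 j - pdf_mean g ord0 j) * g x))%R.

End densities.

Section random_vectors.
Context {R : realType} {n : nat} {d : measure_display} {T : measurableType d}.
Variables (P : probability T R) (X : {RV P >-> 'rV[R]_n}).

Definition has_pdf (f : 'rV[R]_n -> R) : Prop :=
  is_pdf f /\ forall A : set 'rV[R]_n, measurable A ->
    distribution P X A = (\int[lebesgue_rV n]_(x in A) (f x)%:E)%E.

Definition finite_second_moments : Prop := forall i : 'I_n,
  P.-integrable setT (fun t => (X t ord0 i ^+ 2)%:E).

Definition cov : 'M[R]_n := \matrix_(i, j)
  fine (covariance P (fun t => X t ord0 i) (fun t => X t ord0 j)).

(* some density of X; densities of X agree almost everywhere, so the entropy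
   does not depend on the choice *)
Definition pdf_of : 'rV[R]_n -> R := xget (cst 0) [set f | has_pdf f].

Definition shannon_entropy : \bar R := (- Ent (lebesgue_rV n) pdf_of)%E.

(* expeR -oo = 0 *)
Definition entropy_power : \bar R :=
  ((2 * pi * expR 1)^-1%:E * expeR ((2 / n%:R)%:E * shannon_entropy))%E.

End random_vectors.

Section assertions.
Variables (R : realType) (n : nat).

Definition assertion_i : Prop :=
  forall f : 'rV[R]_n -> R,
    smooth f -> (forall x, 0 <= f x) ->
    (gauss_rV n).-integrable setT (fun x => (f x)%:E) ->
    (gauss_rV n).-integrable setT (fun x => (enorm (gradient f x))%:E) ->
  ((enorm (\row_i (\int[gauss_rV n]_x gradient f x ord0 i)%R) ^+ 2)%:E <=
   2%:E * Ent (gauss_rV n) f * \int[gauss_rV n]_x (f x)%:E)%E.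

Definition assertion_ii : Prop :=
  forall g : 'rV[R]_n -> R,
    smooth g -> is_pdf g -> pdf_finite_second_moments g ->
  (- Ent (lebesgue_rV n) g <=
   (n%:R / 2 * ln (2 * pi * expR 1 / n%:R * \tr (pdf_cov g)))%:E)%E.

Definition assertion_iii : Prop :=
  forall (d : measure_display) (T : measurableType d) (P : probability T R)
    (X : {RV P >-> 'rV[R]_n}),
    (exists2 f, smooth f & has_pdf X f) -> finite_second_moments X ->
  (n%:R%:E * entropy_power X <= (\tr (cov X))%:E)%E.

Definition assertion_iv : Prop :=
  forall (d : measure_display) (T : measurableType d) (P : probability T R)
    (X : {RV P >-> 'rV[R]_n}),
    (exists2 f, smooth f & has_pdf X f) -> finite_second_moments X ->
  (entropy_power X <= (\det (cov X) `^ (n%:R^-1))%:E)%E.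

End assertions.

(* Main.v *)
Require Import Defs.
From mathcomp Require Import all_boot all_order all_algebra.
From mathcomp Require Import all_classical all_reals all_analysis.
From mathcomp Require Import measurable_realfun.
From mathcomp Require Import ring lra.

(** All four assertions are instances of Gibbs' inequality
    [a ln b + a - b <= a ln a], integrated against Gaussian weights.

    For a probability density [g] with finite second moments, comparison with
    the Gaussian density of the same mean and of an arbitrary positive definite
    covariance [K] gives
    [- Ent g <= (n ln (2 pi) + ln (det K) + tr (K^-1 cov g)) / 2].  The choice
    [K = (tr (cov g) / n) I] yields (ii) and (iii), the choice [K = cov g]
    yields (iv).  The normalisation of the Gaussian comes from Schur complements,
    one coordinate at a time, and [cov g] is positive definite because
    hyperplanes are null sets.

    For (i), comparing [f] with [m exp (a . x - |a|^2 / 2)], where [m = E f],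
    gives [a . E (x f) - m |a|^2 / 2 <= Ent f]; take [a = E (x f) / m].  Gaussian
    integration by parts turns [E (x f)] into [E (grad f)]. *)

Set Implicit Arguments.
Unset Strict Implicit.
Unset Printing Implicit Defensive.
Import Order.TTheory GRing.Theory Num.Theory.
Import numFieldNormedType.Exports.

Local Open Scope classical_set_scope.
Local Open Scope ring_scope.

(** * Comparison of extended integrals, and integration against a measure with a density *)

Section integral_lemmas.
Context {d : measure_display} {T : measurableType d} {R : realType}.
Local Open Scope ereal_scope.
Implicit Types mu nu : {measure set T -> \bar R}.

(** The negative part of [k] lies below that of [h], so a non-finite integral of [k] can only be
    [+oo]. This form is what allows infinite entropies below. *)
Lemma le_integral_integrable_l mu (h k : T -> R) :
  mu.-integrable setT (EFin \o h) -> measurable_fun setT k ->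
  (forall x, (h x <= k x)%R) -> \int[mu]_x (h x)%:E <= \int[mu]_x (k x)%:E.
Proof.
move=> ih mk hk.
have [kfin|kinf] := boolP (\int[mu]_x (k x)%:E \is a fin_num).
  apply: le_integral => //; last by move=> x _; rewrite lee_fin.
  by apply/integrableP; split; [exact/measurable_EFinP|rewrite integral_fin_num_abs].
have kn : \int[mu]_x (EFin \o k)^\- x < +oo.
  apply: le_lt_trans (integral_funeneg_lt_pinfty measurableT ih).
  apply: ge0_le_integral => //.
  - by apply: measurable_funeneg; exact/measurable_EFinP.
  - by apply: measurable_funeneg; exact: measurable_int ih.
  - by move=> x _; apply: (@funeneg_le _ _ setT) => [y _|]; rewrite ?inE ?lee_fin//=.
move: kinf; rewrite integralE; move: kn.
rewrite -ge0_fin_numE ?integral_ge0// => /fineK <-.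
have : 0 <= \int[mu]_x (EFin \o k)^\+ x by exact: integral_ge0.
by case: (\int[mu]_x (EFin \o k)^\+ x) => [r| |]//= _; rewrite leey.
Qed.

Section density.
Variables (mu nu : {measure set T -> \bar R}) (g : T -> R).
Hypotheses (mg : measurable_fun setT g) (g0 : forall x, (0 <= g x)%R).
Hypothesis nuE : forall A, measurable A -> nu A = \int[mu]_(x in A) (g x)%:E.

Import HBNNSimple.

Lemma integral_density_nnsfun (h : {nnsfun T >-> R}) :
  \int[nu]_x (h x)%:E = \int[mu]_x ((h x)%:E * (g x)%:E).
Proof.
under [LHS]eq_integral do rewrite fimfunE -fsumEFin//.
rewrite [LHS]ge0_integral_fsum//; last 2 first.
  - by move=> r; exact/measurable_EFinP/measurableT_comp.
  - by move=> n x _; rewrite EFinM nnfun_muleindic_ge0.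
under [RHS]eq_integral.
  move=> x xD; rewrite fimfunE -fsumEFin// ge0_mule_fsuml; last first.
    by move=> r; rewrite EFinM nnfun_muleindic_ge0.
  over.
have mrg r : measurable_fun setT
    (fun x => (r * \1_(h @^-1` [set r]) x)%:E * (g x)%:E).
  apply: emeasurable_funM; last exact/measurable_EFinP.
  by apply/measurable_EFinP/measurable_funM.
rewrite [RHS]ge0_integral_fsum//; last first.
  by move=> n x _; rewrite mule_ge0 ?lee_fin//; exact: nnfun_muleindic_ge0.
apply: eq_fsbigr => r _; rewrite integralZl_indic_nnsfun// integral_indic// setIT.
have mr : measurable (h @^-1` [set r]) by [].
rewrite nuE// [X in _ * X]integral_mkcond.
(* A negative value has an empty level set; the scalar can be pulled out of the integral once
   [0 <= r]. *)
have [r0|r0] := ltP r 0%R.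
  rewrite preimage_nnfun0// /patch.
  under eq_integral do rewrite in_set0.
  rewrite integral0 mule0 integral0_eq// => x _.
  by rewrite indic0 mulr0 mul0e.
rewrite -ge0_integralZl//.
- apply: eq_integral => x _; rewrite indicE patchE; case: ifPn => _.
    by rewrite mulr1.
  by rewrite mulr0 mul0e mule0.
- apply/(measurable_restrictT _ mr).
  by apply/measurable_EFinP/measurable_funTS.
- by move=> x _; rewrite patchE; case: ifPn; rewrite // lee_fin.
Qed.

(** Monotone convergence along the simple approximations of [f], applied on both sides. *)
Lemma ge0_integral_density (f : T -> \bar R) :
  measurable_fun setT f -> (forall x, 0 <= f x) ->
  \int[nu]_x f x = \int[mu]_x (f x * (g x)%:E).
Proof.
move=> mf f0; pose f_ := nnsfun_approx measurableT mf.
transitivity (limn (fun n => \int[nu]_x (f_ n x)%:E)).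
  rewrite -monotone_convergence//=.
  - apply: eq_integral => x _; apply/esym/cvg_lim => //=.
    exact: cvg_nnsfun_approx.
  - by move=> n; exact/measurable_EFinP/measurable_funTS.
  - by move=> n x _; rewrite lee_fin.
  - by move=> x _ a b ab; rewrite lee_fin; exact/lefP/nd_nnsfun_approx.
under eq_fun do rewrite integral_density_nnsfun.
rewrite -monotone_convergence//=.
- apply: eq_integral => x _; apply/cvg_lim => //=.
  by apply: cvgeZr => //; exact: cvg_nnsfun_approx.
- by move=> n; apply: emeasurable_funM; exact/measurable_EFinP.
- by move=> n x _; rewrite mule_ge0// lee_fin.
- move=> x _ a b ab; rewrite lee_wpmul2r ?lee_fin//.
  exact/lefP/nd_nnsfun_approx.
Qed.

(** Multiplication by [g >= 0] commutes with taking positive and negative parts. *)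
Lemma integral_density (f : T -> R) : measurable_fun setT f ->
  \int[nu]_x (f x)%:E = \int[mu]_x (f x * g x)%:E.
Proof.
move=> mf; rewrite integralE [RHS]integralE.
rewrite !ge0_integral_density//; last 2 first.
- by apply: measurable_funeneg; exact/measurable_EFinP.
- by apply: measurable_funepos; exact/measurable_EFinP.
congr (_ - _); apply: eq_integral => x _.
- rewrite !funeposE/= -!EFin_max -EFinM; congr EFin.
  by rewrite maxr_pMl// mul0r.
- rewrite !funenegE/= -!EFin_max -EFinM; congr EFin.
  by rewrite maxr_pMl// mul0r mulNr.
Qed.

Lemma integrable_density (f : T -> R) : measurable_fun setT f ->
  nu.-integrable setT (EFin \o f) <->
  mu.-integrable setT (EFin \o (f \* g)%R).
Proof.
move=> mf; have E : \int[nu]_x `|(f x)%:E| = \int[mu]_x `|(f x * g x)%:E|.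
  rewrite ge0_integral_density//; last first.
    by apply: measurableT_comp => //; exact/measurable_EFinP.
  by apply: eq_integral => x _ /=; rewrite normrM (ger0_norm (g0 x)).
split=> /integrableP[_ foo]; apply/integrableP; split.
- by apply/measurable_EFinP; exact: measurable_funM.
- by rewrite /= -E.
- exact/measurable_EFinP.
- by rewrite /= E.
Qed.

End density.

End integral_lemmas.

(** * Lebesgue measure on row vectors: Tonelli, translation invariance, hyperplanes *)

Section lebesgue_rV_theory.
Context {R : realType}.

Lemma cons_rV0 n (x : R) (v : 'rV[R]_n) : cons_rV (x, v) ord0 ord0 = x.
Proof. by have /(congr1 fst) := cons_rVK (x, v). Qed.

Lemma cons_rVS n (x : R) (v : 'rV[R]_n) (i : 'I_n) :
  cons_rV (x, v) ord0 (lift ord0 i) = v ord0 i.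
Proof.
have /(congr1 snd)/rowP/(_ i)/= <- := cons_rVK (x, v).
by rewrite [RHS]mxE; congr fun_of_matrix; exact/val_inj.
Qed.

Lemma cons_rVD n (x y : R) (v w : 'rV[R]_n) :
  cons_rV (x, v) + cons_rV (y, w) = cons_rV (x + y, v + w).
Proof.
apply/rowP => i; rewrite mxE; have [j ->|->] := unliftP ord0 i.
- by rewrite !cons_rVS mxE.
- by rewrite !cons_rV0.
Qed.

Lemma measurable_dot_rV n (a : 'I_n -> R) :
  measurable_fun setT (fun x : 'rV[R]_n => \sum_i a i * x ord0 i).
Proof.
by apply: measurable_sum => i; apply: measurable_funM => //; exact: measurable_coord.
Qed.

Lemma measurable_translate_rV n (a : 'rV[R]_n) :
  measurable_fun setT (fun x : 'rV[R]_n => x + a).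
Proof.
apply: measurable_fun_rVP => i.
rewrite (_ : (fun _ => _) = fun x : 'rV[R]_n => x ord0 i + a ord0 i); last first.
  by apply/funext => x; rewrite mxE.
by apply: measurable_funD => //; exact: measurable_coord.
Qed.

Local Open Scope ereal_scope.

(** Tonelli for the product measure whose pushforward along [cons_rV] is [lebesgue_rV n.+1]. *)
Lemma ge0_integral_rVS n (f : 'rV[R]_n.+1 -> \bar R) :
  measurable_fun setT f -> (forall x, 0 <= f x) ->
  \int[lebesgue_rV n.+1]_x f x =
  \int[lebesgue_rV n]_v \int[lebesgue_measure]_x f (cons_rV (x, v)).
Proof.
move=> mf f0; have mcons := @measurable_cons_rV R n.
transitivity (\int[@lebesgue_measure R \x @lebesgue_rV R n]_p f (cons_rV p)).
  have := ge0_integral_pushforward mcons (@lebesgue_measure R \x @lebesgue_rV R n)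
    measurableT mf (fun x _ => f0 x).
  by rewrite preimage_setT => <-; exact: eq_measure_integral.
rewrite (fubini_tonelli2 (f \o @cons_rV R n))//.
- exact: measurableT_comp.
- by move=> p; exact: f0.
Qed.

Lemma ge0_integral_rVS_swap n (f : 'rV[R]_n.+1 -> \bar R) :
  measurable_fun setT f -> (forall x, 0 <= f x) ->
  \int[lebesgue_rV n.+1]_x f x =
  \int[lebesgue_measure]_x \int[lebesgue_rV n]_v f (cons_rV (x, v)).
Proof.
move=> mf f0; rewrite ge0_integral_rVS//.
rewrite -(fubini_tonelli (f \o @cons_rV R n))//.
- by apply: measurableT_comp => //; exact: measurable_cons_rV.
- by move=> p; exact: f0.
Qed.

(** The translated measure gives half-open intervals their length, and Lebesgue measure is unique
    with this property. *)
Lemma ge0_integral_translate_R (a : R) (f : R -> \bar R) :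
  measurable_fun setT f -> (forall x, 0 <= f x) ->
  \int[lebesgue_measure]_x f (x + a)%R = \int[lebesgue_measure]_x f x.
Proof.
move=> mf f0.
pose phi (x : R) : measurableTypeR R := (x + a)%R.
have mphi : measurable_fun [set: measurableTypeR R] phi.
  exact: (@measurable_funD _ _ _ _ (fun x => x) (cst a)).
have := ge0_integral_pushforward mphi (@lebesgue_measure R) measurableT mf
  (fun x _ => f0 x).
rewrite preimage_setT => <-; apply: eq_measure_integral => A mA _.
apply/esym/lebesgue_measure_unique => //= _ [[b c]] _ <-.
rewrite /pushforward (_ : _ @^-1` _ = `](b - a)%R, (c - a)%R]%classic).
  rewrite !lebesgue_measure_itv/= !lte_fin ltrD2r; case: ifP => // _.
  by congr EFin; rewrite opprB addrA subrK.
by apply/seteqP; split=> x /=; rewrite !in_itv/= /phi ltrBlDr lerBrDr.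
Qed.

(** Induction on the dimension: the tail is translated by the induction hypothesis, the head by
    invariance on the line. *)
Lemma ge0_integral_translate_rV n (a : 'rV[R]_n) (f : 'rV[R]_n -> \bar R) :
  measurable_fun setT f -> (forall x, 0 <= f x) ->
  \int[lebesgue_rV n]_x f (x + a)%R = \int[lebesgue_rV n]_x f x.
Proof.
elim: n a f => [|n IH] a f mf f0.
  by apply: eq_integral => x _; congr f; rewrite [LHS]thinmx0 [RHS]thinmx0.
have mfa : measurable_fun setT (fun x : 'rV[R]_n.+1 => f (x + a)%R).
  by apply: measurableT_comp => //; exact: measurable_translate_rV.
rewrite (ge0_integral_rVS mfa (fun x => f0 _)) (ge0_integral_rVS mf f0).
have mc : measurable_fun setT (f \o @cons_rV R n).
  by apply: measurableT_comp => //; exact: measurable_cons_rV.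
rewrite -(IH (uncons_rV a).2 (fun v => \int[_]_x f (cons_rV (x, v)))); last 2 first.
- exact: (measurable_fun_fubini_tonelli_G (m1 := @lebesgue_measure R)
    (f \o @cons_rV R n) mc (fun p => f0 _)).
- by move=> v; exact: integral_ge0.
apply: eq_integral => v _.
rewrite -[RHS](ge0_integral_translate_R (uncons_rV a).1)//; last first.
  exact: (measurable_fun_pair1 _ mc).
by apply: eq_integral => x _; rewrite -cons_rVD -surjective_pairing uncons_rVK.
Qed.

Lemma integral_translate_rV n (a : 'rV[R]_n) (f : 'rV[R]_n -> R) :
  measurable_fun setT f ->
  \int[lebesgue_rV n]_x (f (x + a)%R)%:E = \int[lebesgue_rV n]_x (f x)%:E.
Proof.
move=> mf; rewrite integralE [RHS]integralE.
rewrite -(ge0_integral_translate_rV a (f := (EFin \o f)^\+))//; last first.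
  by apply: measurable_funepos; exact/measurable_EFinP.
rewrite -(ge0_integral_translate_rV a (f := (EFin \o f)^\-))//; last first.
  by apply: measurable_funeneg; exact/measurable_EFinP.
by congr (_ - _); apply: eq_integral => x _; rewrite ?funeposE ?funenegE.
Qed.

Lemma integrable_translate_rV n (a : 'rV[R]_n) (f : 'rV[R]_n -> R) :
  (lebesgue_rV n).-integrable setT (EFin \o f) ->
  (lebesgue_rV n).-integrable setT (fun x => (f (x + a)%R)%:E).
Proof.
move=> /integrableP[mf foo]; apply/integrableP; split.
  by apply: (measurableT_comp mf); exact: measurable_translate_rV.
rewrite (ge0_integral_translate_rV a (f := fun x => `|(f x)%:E|))//.
exact: measurableT_comp.
Qed.

(** Induction by slicing. If [a ord0] vanishes, slices at a fixed head are hyperplanes in one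
    dimension less; otherwise slices at a fixed tail are single points. *)
Lemma lebesgue_rV_hyperplane n (a : 'I_n -> R) (c : R) :
  (exists i, a i != 0%R) ->
  lebesgue_rV n [set x : 'rV[R]_n | (\sum_i a i * x ord0 i)%R = c] = 0.
Proof.
elim: n a c => [|n IH] a c [i ai0]; first by case: i ai0.
have mH m (b : 'I_m -> R) e :
    measurable [set x : 'rV[R]_m | (\sum_i b i * x ord0 i)%R = e].
  rewrite -[X in measurable X]setTI.
  exact: (measurable_dot_rV b measurableT (measurable_set1 e)).
rewrite -[X in lebesgue_rV _ X]setIT -integral_indic//; last exact: mH.
set A := [set _ | _].
have Acons x v : A (cons_rV (x, v)) <->
    (a ord0 * x + \sum_i a (lift ord0 i) * v ord0 i = c)%R.
  rewrite /A/= (_ : (\sum_i _)%R =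
    (a ord0 * x + \sum_i a (lift ord0 i) * v ord0 i)%R)//.
  rewrite big_ord_recl cons_rV0; congr (_ + _)%R.
  by apply: eq_bigr => j _; rewrite cons_rVS.
have mA : measurable_fun setT (fun x : 'rV[R]_n.+1 => (\1_A x)%:E : \bar R).
  by apply/measurable_EFinP/measurable_indic; exact: mH.
have [a00|a00] := eqVneq (a ord0) 0%R.
  rewrite ge0_integral_rVS_swap//.
  apply: integral0_eq => x _.
  pose B := [set v : 'rV[R]_n | (\sum_i a (lift ord0 i) * v ord0 i)%R = c].
  transitivity (\int[lebesgue_rV n]_v (\1_B v)%:E).
    apply: eq_integral => v _; rewrite !indicE; congr (_%:R%:E); congr nat_of_bool.
    have := Acons x v; rewrite a00 mul0r add0r => AB.
    by apply/idP/idP; rewrite !inE; apply AB.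
  rewrite integral_indic ?setIT//; last exact: mH.
  apply: IH; have [j ij|i0] := unliftP ord0 i; first by exists j; rewrite -ij.
  by move: ai0; rewrite i0 a00 eqxx.
rewrite ge0_integral_rVS//.
apply: integral0_eq => v _.
pose r := ((c - \sum_i a (lift ord0 i) * v ord0 i) / a ord0)%R.
transitivity (\int[lebesgue_measure]_x (\1_[set r] x)%:E).
  apply: eq_integral => x _; rewrite !indicE; congr (_%:R%:E); congr nat_of_bool.
  apply/idP/idP; rewrite !inE/=.
  - by move=> /Acons E; rewrite /r -E addrK mulrAC divff// mul1r.
  - by move=> ->; apply/Acons; rewrite /r mulrCA divff// mulr1 subrK.
by rewrite integral_indic// setIT; exact: lebesgue_measure_set1.
Qed.

End lebesgue_rV_theory.

(** * Positive definite matrices and the Gaussian integral *)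

Section gaussian_integral.
Context {R : realType}.

Definition posdef n (K : 'M[R]_n) : Prop :=
  K^T = K /\ forall v : 'rV[R]_n, v != 0 -> 0 < (v *m K *m v^T) ord0 ord0.

Lemma posdef_unitmx n (K : 'M[R]_n) : posdef K -> K \in unitmx.
Proof.
move=> [_ Kpos]; rewrite -row_free_unit; apply: inj_row_free => v vK0.
apply/eqP; apply: contraT => /Kpos.
by rewrite vK0 mul0mx mxE ltxx.
Qed.

Lemma posdef_scalar n (s : R) : 0 < s -> posdef (s%:M : 'M[R]_n).
Proof.
move=> s0; split=> [|v v0]; first exact: tr_scalar_mx.
rewrite mul_mx_scalar -scalemxAl mxE mulr_gt0// mxE.
have [i vi0] : exists i, v ord0 i != 0 by exact/rV0Pn.
rewrite (bigD1 i)//= mxE ltr_pwDl//; first by rewrite -expr2 exprn_even_gt0.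
by apply: sumr_ge0 => j _; rewrite mxE -expr2 sqr_ge0.
Qed.

Lemma quad_formE n (M : 'M[R]_n) (x : 'rV[R]_n) :
  (x *m M *m x^T) ord0 ord0 =
  \sum_i \sum_j M i j * (x ord0 i * x ord0 j).
Proof.
rewrite mxE exchange_big; apply: eq_bigr => j _; rewrite !mxE mulr_suml.
by apply: eq_bigr => i _; rewrite mulrAC mulrC mulrA.
Qed.

Lemma measurable_quad_form n (M : 'M[R]_n) :
  measurable_fun setT (fun x : 'rV[R]_n => (x *m M *m x^T) ord0 ord0).
Proof.
under eq_fun do rewrite quad_formE.
apply: measurable_sum => i; apply: measurable_sum => j.
by apply: measurable_funM => //; apply: measurable_funM; exact: measurable_coord.
Qed.

(** The integrand is the normal density of mean [t] and variance [s] divided by its peak, and the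
    peak is the inverse of the claimed value. *)
Lemma integral_gaussian_R (t s : R) : 0 < s ->
  (\int[lebesgue_measure]_x (expR (- ((x - t) ^+ 2 / s) / 2))%:E =
   (Num.sqrt (2 * pi * s))%:E)%E.
Proof.
move=> s0; have ss0 : Num.sqrt s != 0 by rewrite gt_eqF ?sqrtr_gt0.
have peak0 : 0 < normal_peak (Num.sqrt s) by exact: normal_peak_gt0.
have peakE : normal_peak (Num.sqrt s) * Num.sqrt (2 * pi * s) = 1.
  rewrite /normal_peak sqr_sqrtr ?ltW// (_ : s * pi *+ 2 = 2 * pi * s).
    by rewrite mulVf// gt_eqF// sqrtr_gt0 !mulr_gt0// pi_gt0.
  by ring.
transitivity (\int[lebesgue_measure]_x
    ((Num.sqrt (2 * pi * s))%:E * (normal_pdf t (Num.sqrt s) x)%:E))%E.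
  apply: eq_integral => x _; rewrite normal_pdfE// -EFinM; congr EFin.
  rewrite mulrA [_ * normal_peak _]mulrC peakE mul1r /normal_fun; congr expR.
  by rewrite sqr_sqrtr ?ltW//; field; rewrite gt_eqF.
rewrite ge0_integralZl//.
- by rewrite integral_normal_pdf mule1.
- by apply/measurable_EFinP; exact: measurable_normal_pdf.
- by move=> x _; rewrite lee_fin normal_pdf_ge0.
Qed.

(* Schur complement: with c = b K'^-1, the block matrix K is
   U diag(s, K') U^T, U unit upper triangular with corner c. *)
Lemma posdef_schur n (K : 'M[R]_(1 + n)) : posdef K ->
  exists (K' : 'M[R]_n) (s : R) (c : 'rV[R]_n),
  [/\ posdef K', 0 < s, \det K = s * \det K' &
    forall (x : R) (v : 'rV[R]_n),
      (row_mx x%:M v *m invmx K *m (row_mx x%:M v)^T) ord0 ord0 =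
      (x - (v *m c^T) ord0 ord0) ^+ 2 / s +
      (v *m invmx K' *m v^T) ord0 ord0].
Proof.
move=> Kpd; have [Ksym Kpos] := Kpd.
pose a := ulsubmx K; pose b := ursubmx K; pose K' := drsubmx K.
have blK : K = block_mx a b b^T K'.
  by rewrite /a /b /K' trmx_ursub Ksym submxK.
have K'sym : K'^T = K' by rewrite /K' trmx_drsub Ksym.
have K'pd : posdef K'.
  split=> // v v0.
  (* Testing [K] on [(0, v)] leaves the quadratic form of [K']. *)
  have /Kpos : row_mx (0 : 'M[R]_1) v != 0.
    by apply: contra v0 => /eqP; rewrite -row_mx0 => /eq_row_mx[_ ->].
  rewrite blK mul_row_block !mul0mx !add0r tr_row_mx mul_row_col trmx0.
  by rewrite mulmx0 add0r.
have K'u := posdef_unitmx K'pd.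
pose c := b *m invmx K'; pose S := a - c *m b^T; pose s := S ord0 ord0.
have SE : S = s%:M by rewrite [LHS]mx11_scalar.
have cK' : c *m K' = b by rewrite /c mulmxKV.
have K'c : K' *m c^T = b^T by rewrite -{1}K'sym -trmx_mul cK'.
have s0 : 0 < s.
  (* Testing [K] on [(1, - c)] gives exactly the Schur complement [s]. *)
  have /Kpos : row_mx (1%:M : 'M[R]_1) (- c) != 0.
    apply/eqP; rewrite -row_mx0 => /eq_row_mx[/matrixP/(_ ord0 ord0)].
    by rewrite !mxE => /eqP; rewrite oner_eq0.
  rewrite blK mul_row_block !mul1mx !mulNmx cK' subrr tr_row_mx mul_row_col.
  by rewrite mul0mx addr0 trmx1 mulmx1.
have KE : K = block_mx 1%:M c 0 1%:M *m block_mx s%:M 0 0 K'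
              *m block_mx 1%:M 0 c^T 1%:M.
  rewrite [LHS]blK !mulmx_block !mul1mx !mulmx1 !mul0mx !mulmx0 !addr0 !add0r.
  by rewrite -mulmxA K'c cK' -SE subrK.
exists K', s, c; split => //.
  by rewrite KE !det_mulmx det_ublock !det_lblock !det1 !mul1r !mulr1 det_scalar1.
(* Inverses of the three factors of [K]; their product in reverse order is [invmx K]. *)
pose L1 := block_mx 1%:M 0 (- c^T) (1%:M : 'M[R]_n).
pose D1 := block_mx (s^-1%:M : 'M[R]_1) 0 0 (invmx K').
pose U1 := block_mx 1%:M (- c) 0 (1%:M : 'M[R]_n).
have LL : L1 *m block_mx 1%:M 0 c^T 1%:M = 1%:M.
  rewrite mulmx_block !mul1mx !mulmx1 !mul0mx !mulmx0 !addr0 !add0r addNr.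
  by rewrite -scalar_mx_block.
have DD : D1 *m block_mx s%:M 0 0 K' = 1%:M.
  rewrite mulmx_block !mul0mx !mulmx0 !addr0 !add0r mulVmx// -scalar_mxM.
  by rewrite mulVf ?gt_eqF// -scalar_mx_block.
have UU : U1 *m block_mx 1%:M c 0 1%:M = 1%:M.
  rewrite mulmx_block !mul1mx !mulmx1 !mul0mx !mulmx0 !addr0 !add0r subrr.
  by rewrite -scalar_mx_block.
have invK : invmx K = L1 *m D1 *m U1.
  have MK : L1 *m D1 *m U1 *m K = 1%:M.
    rewrite KE !mulmxA -(mulmxA (L1 *m D1)) UU mulmx1 -(mulmxA L1) DD.
    by rewrite mulmx1 LL.
  by rewrite -[LHS]mul1mx -MK mulmxK// posdef_unitmx.
move=> x v; rewrite invK !mulmxA.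
rewrite mul_row_block !mulmx1 mulmxN -mulmxA.
have -> : block_mx 1%:M (- c) 0 (1%:M : 'M[R]_n) *m (row_mx x%:M v)^T =
    (row_mx (x%:M - v *m c^T) v)^T.
  rewrite !tr_row_mx mul_block_col !mul1mx mul0mx add0r mulNmx.
  by rewrite linearB/= trmx_mul trmxK tr_scalar_mx.
rewrite mulmx0 add0r mul_row_block !mulmx0 addr0 add0r tr_row_mx mul_row_col.
rewrite mxE; congr (_ + _).
have -> : x%:M - v *m c^T = (x - (v *m c^T) ord0 ord0)%:M.
  by rewrite [v *m c^T in LHS]mx11_scalar -raddfB.
by rewrite tr_scalar_mx -!scalar_mxM mxE eqxx mulr1n mulrAC -expr2.
Qed.

(** Induction on [n]: the Schur complement completes the square in the first coordinate, whose
    integral is [sqrt (2 pi s)], and the Gaussian of [K'] remains. The sign of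
    [\det K = s * \det K'] follows in the same induction. *)
Lemma integral_gaussian_rV n (K : 'M[R]_n) : posdef K -> 0 < \det K /\
  (\int[lebesgue_rV n]_x (expR (- (x *m invmx K *m x^T) ord0 ord0 / 2))%:E =
   (Num.sqrt ((2 * pi) ^+ n * \det K))%:E)%E.
Proof.
elim: n K => [|n IH] K Kpd.
  rewrite det_mx00; split => //.
  rewrite integral_dirac//; last first.
    apply/measurable_EFinP; apply: measurableT_comp => //.
    by apply: measurable_funM => //; apply: measurableT_comp => //;
      exact: measurable_quad_form.
  by rewrite diracT mul1e !mul0mx mxE oppr0 mul0r expR0 expr0 mul1r sqrtr1.
have [K' [s [c [K'pd s0 detK quadK]]]] := posdef_schur Kpd.
have [detK'0 intK'] := IH _ K'pd.
split; first by rewrite detK mulr_gt0.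
have me m (M : 'M[R]_m) : measurable_fun setT
    (fun x : 'rV[R]_m => (expR (- (x *m M *m x^T) ord0 ord0 / 2))%:E).
  apply/measurable_EFinP; apply: measurableT_comp => //.
  by apply: measurable_funM => //; apply: measurableT_comp => //;
    exact: measurable_quad_form.
have e0 (y : R) : (0 <= (expR y)%:E)%E by rewrite lee_fin expR_ge0.
rewrite (ge0_integral_rVS (me _ _) (fun x => e0 _)).
transitivity (\int[lebesgue_rV n]_v ((Num.sqrt (2 * pi * s))%:E *
    (expR (- (v *m invmx K' *m v^T) ord0 ord0 / 2))%:E))%E; last first.
  rewrite ge0_integralZl//; last exact: me.
  rewrite intK' -EFinM -sqrtrM ?mulr_ge0 ?pi_ge0 ?ltW//.
  by rewrite detK exprS; congr (Num.sqrt _)%:E; ring.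
apply: eq_integral => v _.
(* The constant is turned back into the one-dimensional Gaussian integral centred at [v c^T], so
   that both sides become integrals in [x]. *)
rewrite -(integral_gaussian_R ((v *m c^T) ord0 ord0) s0) -ge0_integralZr//.
- apply: eq_integral => x _; rewrite -EFinM -expRD /cons_rV/= quadK.
  by congr (expR _)%:E; ring.
- apply/measurable_EFinP; apply: measurableT_comp => //.
  apply: measurable_funM => //; apply: measurableT_comp => //.
  apply: measurable_funM => //; apply: measurable_funX.
  exact: measurable_funB.
Qed.

End gaussian_integral.

(** * Integrability and finite sums for real-valued functions *)

Section real_integrable.
Context {d : measure_display} {T : measurableType d} {R : realType}.
Variable mu : {measure set T -> \bar R}.
Local Notation integrableR f := (mu.-integrable setT (fun x => (f x)%:E)).
Implicit Types f g : T -> R.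

Lemma integrableRD f g : integrableR f -> integrableR g ->
  integrableR (fun x => f x + g x).
Proof. by move=> fi gi; exact: (integrableD measurableT fi gi). Qed.

Lemma integrableRB f g : integrableR f -> integrableR g ->
  integrableR (fun x => f x - g x).
Proof. by move=> fi gi; exact: (integrableB measurableT fi gi). Qed.

Lemma integrableRZl (k : R) f : integrableR f -> integrableR (fun x => k * f x).
Proof. by move=> fi; exact: (integrableZl measurableT k fi). Qed.

Lemma integrableR_sum (I : Type) (s : seq I) (f : I -> T -> R) :
  (forall i, integrableR (f i)) -> integrableR (fun x => \sum_(i <- s) f i x).
Proof.
move=> fi; have := integrable_sum measurableT s (P := xpredT) (fun i _ => fi i).
by under eq_fun do rewrite sumEFin.
Qed.

Lemma le_integrableR f g : measurable_fun setT f ->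
  (forall x, `|f x| <= g x) -> integrableR g -> integrableR f.
Proof.
move=> mf fg; apply: le_integrable => //; first exact/measurable_EFinP.
by move=> x _; rewrite lee_fin (le_trans (fg x))// ler_norm.
Qed.

Lemma measurable_integrableR f : integrableR f -> measurable_fun setT f.
Proof. by move=> fi; apply/measurable_EFinP; exact: measurable_int fi. Qed.

Lemma Rintegral_sum (I : Type) (s : seq I) (f : I -> T -> R) :
  (forall i, integrableR (f i)) ->
  (\int[mu]_x (\sum_(i <- s) f i x) = \sum_(i <- s) \int[mu]_x f i x)%R.
Proof.
move=> fi; elim: s => [|i s IH].
  rewrite big_nil /Rintegral; under eq_integral do rewrite big_nil.
  by rewrite integral0.
rewrite big_cons -IH -RintegralD//; [|exact: fi|exact: integrableR_sum].
by apply: eq_Rintegral => x _; rewrite big_cons.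
Qed.

Lemma EFin_Rintegral f : integrableR f ->
  ((\int[mu]_x f x)%R)%:E = (\int[mu]_x (f x)%:E)%E.
Proof. by move=> fi; rewrite fineK//; exact: integrable_fin_num. Qed.

End real_integrable.

(** This is [ln y <= y - 1] at [y = b / a], multiplied by [a]; at [a = 0] the products with [ln]
    vanish. *)
Lemma gibbs_pointwise (R : realType) (a b : R) : 0 <= a -> 0 < b ->
  a * ln b + a - b <= a * ln a.
Proof.
rewrite le_eqVlt => /predU1P[<-|a0] b0.
  by rewrite !mul0r add0r sub0r oppr_le0 ltW.
have : ln (b / a) <= b / a - 1.
  rewrite lerBrDr -[leRHS]lnK ?posrE ?divr_gt0// addrC.
  exact: expR_ge1Dx.
rewrite ln_div ?posrE// => /(ler_wpM2l (ltW a0)).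
by rewrite !mulrBr mulr1 mulrCA divff ?gt_eqF// mulr1; lra.
Qed.

(** * Densities with finite second moments: covariance and entropy bounds *)

Section second_moments.
Context {R : realType} {n : nat}.
Variable g : 'rV[R]_n -> R.
Hypotheses (gpdf : is_pdf g) (g2 : pdf_finite_second_moments g).
Local Notation mu := (lebesgue_rV n : {measure set 'rV[R]_n -> \bar R}).
Local Notation m := (pdf_mean g).

Let mg : measurable_fun setT g. Proof. by case: gpdf. Qed.
Let g0 x : 0 <= g x. Proof. by case: gpdf. Qed.

Lemma integrable_pdf : mu.-integrable setT (fun x => (g x)%:E).
Proof.
have [_ _ g1] := gpdf; apply/integrableP; split; first exact/measurable_EFinP.
by under eq_integral do rewrite /= ger0_norm//; rewrite g1 ltry.
Qed.

Lemma Rintegral_pdf : (\int[mu]_x g x)%R = 1.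
Proof. by have [_ _ g1] := gpdf; rewrite /Rintegral g1. Qed.

Let mcoord i : measurable_fun setT (fun x : 'rV[R]_n => x ord0 i).
Proof. exact: measurable_coord. Qed.

(** Domination by second moments, from [|s t| <= s^2 + t^2]. *)
Lemma integrable_pdf_coordM i j :
  mu.-integrable setT (fun x => (x ord0 i * x ord0 j * g x)%:E).
Proof.
apply: (le_integrableR (g := fun x : 'rV[R]_n => x ord0 i ^+ 2 * g x + x ord0 j ^+ 2 * g x)).
- by apply: measurable_funM => //; exact: measurable_funM.
- move=> x; rewrite -mulrDl normrM (ger0_norm (g0 x)) ler_wpM2r// normrM.
  rewrite -[x ord0 i ^+ 2]real_normK ?num_real//.
  rewrite -[x ord0 j ^+ 2]real_normK ?num_real//.
  have := sqr_ge0 (`|x ord0 i| - `|x ord0 j|).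
  by have := normr_ge0 (x ord0 i); have := normr_ge0 (x ord0 j); nra.
- exact: integrableRD.
Qed.

Lemma integrable_pdf_coord i : mu.-integrable setT (fun x => (x ord0 i * g x)%:E).
Proof.
apply: (le_integrableR (g := fun x : 'rV[R]_n => x ord0 i ^+ 2 * g x + g x)).
- exact: measurable_funM.
- move=> x; rewrite -{3}[g x]mul1r -mulrDl normrM (ger0_norm (g0 x)) ler_wpM2r//.
  rewrite -[x ord0 i ^+ 2]real_normK ?num_real//.
  have := sqr_ge0 (`|x ord0 i| - 1).
  by have := normr_ge0 (x ord0 i); nra.
- by apply: integrableRD => //; exact: integrable_pdf.
Qed.

Lemma integrable_pdf_central i j : mu.-integrable setT
  (fun x => ((x ord0 i - m ord0 i) * (x ord0 j - m ord0 j) * g x)%:E).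
Proof.
apply: eq_integrable (integrableRD (integrableRB (integrableRB
  (integrable_pdf_coordM i j)
  (integrableRZl (m ord0 j) (integrable_pdf_coord i)))
  (integrableRZl (m ord0 i) (integrable_pdf_coord j)))
  (integrableRZl (m ord0 i * m ord0 j) integrable_pdf)) => // x _.
by congr EFin; ring.
Qed.

Lemma pdf_cov_sym : (pdf_cov g)^T = pdf_cov g.
Proof.
by apply/matrixP => i j; rewrite !mxE; apply: eq_Rintegral => x _; congr (_ * _);
  exact: mulrC.
Qed.

Let quadE (M : 'M[R]_n) x :
  ((x - m) *m M *m (x - m)^T) ord0 ord0 * g x =
  \sum_i \sum_j
    M i j * ((x ord0 i - m ord0 i) * (x ord0 j - m ord0 j) * g x).
Proof.
rewrite quad_formE mulr_suml; apply: eq_bigr => i _.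
rewrite mulr_suml; apply: eq_bigr => j _.
by rewrite -mulrA ![(x - m) _ _]mxE ![(- m) _ _]mxE.
Qed.

Lemma integrable_pdf_quad (M : 'M[R]_n) : mu.-integrable setT
  (fun x => (((x - m) *m M *m (x - m)^T) ord0 ord0 * g x)%:E).
Proof.
under eq_fun do rewrite quadE.
apply: integrableR_sum => i; apply: integrableR_sum => j.
by apply: integrableRZl; exact: integrable_pdf_central.
Qed.

Lemma Rintegral_pdf_quad (M : 'M[R]_n) :
  (\int[mu]_x (((x - m) *m M *m (x - m)^T) ord0 ord0 * g x))%R =
  \sum_i \sum_j M i j * pdf_cov g i j.
Proof.
under eq_Rintegral do rewrite quadE.
have ic i j := integrableRZl (M i j) (integrable_pdf_central i j).
rewrite Rintegral_sum => [|i]; last exact: integrableR_sum.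
apply: eq_bigr => i _; rewrite Rintegral_sum//.
apply: eq_bigr => j _; rewrite RintegralZl//.
  by rewrite [pdf_cov g i j]mxE.
exact: integrable_pdf_central.
Qed.

(** Symmetry of the covariance turns the entrywise pairing into a trace. *)
Lemma trace_mul_pdf_cov (M : 'M[R]_n) :
  \tr (M *m pdf_cov g) = \sum_i \sum_j M i j * pdf_cov g i j.
Proof.
apply: eq_bigr => i _; rewrite mxE; apply: eq_bigr => j _.
by rewrite -[in LHS]pdf_cov_sym [in LHS]mxE.
Qed.

(* A degenerate covariance would force the density to live on a hyperplane. *)
Lemma posdef_pdf_cov : posdef (pdf_cov g).
Proof.
split=> [|v v0]; first exact: pdf_cov_sym.
pose l (x : 'rV[R]_n) := \sum_i v ord0 i * x ord0 i.
(* The rank-one matrix [v^T v] exhibits the quadratic form at [v] as the variance of the linear form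
   [l]. *)
have lE x : ((x - m) *m (v^T *m v) *m (x - m)^T) ord0 ord0 = (l x - l m) ^+ 2.
  have -> : (x - m) *m (v^T *m v) *m (x - m)^T =
    ((x - m) *m v^T) *m (v *m (x - m)^T) by rewrite !mulmxA.
  rewrite mxE big_ord1.
  have -> : ((x - m) *m v^T) ord0 ord0 = l x - l m.
    rewrite mxE /l -sumrB; apply: eq_bigr => i _; rewrite !mxE; ring.
  have -> : (v *m (x - m)^T) ord0 ord0 = l x - l m.
    rewrite mxE /l -sumrB; apply: eq_bigr => i _; rewrite !mxE; ring.
  by rewrite expr2.
have vKv : (v *m pdf_cov g *m v^T) ord0 ord0 =
    (\int[mu]_x ((l x - l m) ^+ 2 * g x))%R.
  under eq_Rintegral do rewrite -lE.
  rewrite Rintegral_pdf_quad quad_formE.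
  apply: eq_bigr => i _; apply: eq_bigr => j _.
  by rewrite mulrC; congr (_ * _); rewrite !mxE big_ord1 mxE.
have ml : measurable_fun setT (fun x => (l x - l m) ^+ 2 * g x).
  apply: measurable_funM => //; apply: measurable_funX.
  by apply: measurable_funB => //; exact: measurable_dot_rV.
have l0 x : 0 <= (l x - l m) ^+ 2 * g x by rewrite mulr_ge0// sqr_ge0.
rewrite vKv lt_def Rintegral_ge0 ?andbT//; apply/eqP => I0.
have il : mu.-integrable setT (fun x => ((l x - l m) ^+ 2 * g x)%:E).
  by have := integrable_pdf_quad (v^T *m v); under eq_fun do rewrite lE.
have ae1 : ae_eq mu setT (fun x => ((l x - l m) ^+ 2 * g x)%:E) (cst 0%E).
  apply/ae_eq_integral_abs => //; first exact/measurable_EFinP.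
  under eq_integral do rewrite /= ger0_norm//.
  by rewrite -EFin_Rintegral// I0.
(* If that variance is zero, [g] vanishes off the null hyperplane [l x = l m], hence almost
   everywhere, against its total mass 1. *)
have ae2 : {ae mu, forall x, l x <> l m}.
  exists [set x | l x = l m]; split.
  - rewrite -[X in measurable X]setTI.
    exact: (measurable_dot_rV _ measurableT (measurable_set1 _)).
  - apply: (@lebesgue_rV_hyperplane _ _ (fun i => v ord0 i)).
    exact/rV0Pn.
  - by move=> x /= /contrapT.
have : (\int[mu]_x (g x)%:E = \int[mu]_x (cst 0%E x))%E.
  apply: ae_eq_integral => //; first exact/measurable_EFinP.
  apply: filterS2 ae1 ae2 => x /= + lx _ => /(_ Logic.I)[] /eqP.
  by rewrite mulf_eq0 expf_eq0/= subr_eq0 => /orP[/eqP//|/eqP->].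
have [_ _ ->] := gpdf; rewrite integral0 => /eqP.
by rewrite onee_eq0.
Qed.

Lemma Ent_pdf : Ent mu g = (\int[mu]_x (g x * ln (g x))%:E)%E.
Proof. by rewrite /Ent Rintegral_pdf ln1 mulr0 sube0. Qed.

(* Gibbs' inequality against the Gaussian with mean [m] and covariance [K]. *)
Lemma Ent_pdf_gaussian_bound (K : 'M[R]_n) : posdef K ->
  (- Ent mu g <= ((n%:R * ln (2 * pi) + ln (\det K)
                   + \tr (invmx K *m pdf_cov g)) / 2)%:E)%E.
Proof.
move=> Kpd; have [dK intK] := integral_gaussian_rV Kpd.
have pi20 : 0 < 2 * pi :> R by rewrite mulr_gt0// pi_gt0.
set t := \tr _; pose c : R := Num.sqrt ((2 * pi) ^+ n * \det K).
have c20 : 0 < (2 * pi) ^+ n * \det K by rewrite mulr_gt0 ?exprn_gt0.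
have c0 : 0 < c by rewrite sqrtr_gt0.
have lnc : ln c = (n%:R * ln (2 * pi) + ln (\det K)) / 2.
  have : ln (c ^+ 2) = n%:R * ln (2 * pi) + ln (\det K).
    rewrite sqr_sqrtr ?ltW// lnM ?posrE ?exprn_gt0// lnXn//.
    by rewrite -[_ *+ n]mulr_natl.
  by rewrite lnXn// => <-; rewrite mulr2n; field.
pose Q (x : 'rV[R]_n) := (x *m invmx K *m x^T) ord0 ord0.
(* The Gaussian density of mean [m] and covariance [K], with normalising constant [c]. *)
pose q x := c^-1 * expR (- Q (x - m) / 2).
have mQ : measurable_fun setT Q by exact: measurable_quad_form.
have mE : measurable_fun setT (fun x => expR (- Q x / 2)).
  apply: measurableT_comp => //; apply: measurable_funM => //.
  exact: measurableT_comp.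
have intE : mu.-integrable setT (fun x => (expR (- Q x / 2))%:E).
  apply/integrableP; split; first exact/measurable_EFinP.
  under eq_integral do rewrite /= ger0_norm ?expR_ge0//.
  by rewrite intK ltry.
have iq : mu.-integrable setT (fun x => (q x)%:E).
  by apply: integrableRZl; exact: (integrable_translate_rV (- m) intE).
have q1 : (\int[mu]_x q x)%R = 1.
  rewrite RintegralZl//; last exact: (integrable_translate_rV (- m) intE).
  rewrite /Rintegral (integral_translate_rV (- m) (f := fun x => expR (- Q x / 2)))//.
  by rewrite intK/= mulVf// gt_eqF.
(* This is [g ln q + g - q] with [ln q] expanded. It is integrable by the second moments, while
   [g ln g] may have integral [+oo]. *)
pose h x := (- ln c) * g x + (- 2^-1) * (Q (x - m) * g x) + g x - q x.
have ig := integrable_pdf; have iQ := integrable_pdf_quad (invmx K).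
have ih1 : mu.-integrable setT
    (fun x => ((- ln c) * g x + (- 2^-1) * (Q (x - m) * g x))%:E).
  by apply: integrableRD; exact: integrableRZl.
have ih2 := integrableRD ih1 ig.
have ih : mu.-integrable setT (fun x => (h x)%:E) by exact: integrableRB.
have hE : (\int[mu]_x h x)%R = - ln c - t / 2.
  rewrite /h RintegralB// q1 RintegralD// Rintegral_pdf RintegralD//;
    try exact: integrableRZl.
  rewrite !RintegralZl// Rintegral_pdf Rintegral_pdf_quad.
  by rewrite -trace_mul_pdf_cov -/t; field.
have mgl : measurable_fun setT (fun x => g x * ln (g x)).
  by apply: measurable_funM => //; exact: measurableT_comp.
have hle x : h x <= g x * ln (g x).
  have q0 : 0 < q x by rewrite mulr_gt0 ?invr_gt0 ?expR_gt0.
  apply: le_trans (gibbs_pointwise (g0 x) q0).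
  rewrite /h /q lnM ?posrE ?invr_gt0 ?expR_gt0// lnV ?posrE// expRK.
  by rewrite le_eqVlt; apply/orP; left; apply/eqP; field; rewrite gt_eqF.
have := le_integral_integrable_l ih mgl hle.
rewrite -EFin_Rintegral// hE Ent_pdf leeNl; apply: le_trans.
by rewrite -EFinN lee_fin lnc le_eqVlt; apply/orP; left; apply/eqP; field.
Qed.

(** Diagonal entries are the quadratic form at basis vectors, hence positive, and [0 < n] supplies
    at least one. *)
Lemma pdf_cov_trace_gt0 : (0 < n)%N -> 0 < \tr (pdf_cov g).
Proof.
move=> n0; have [_ Kpos] := posdef_pdf_cov.
have K0 i : 0 < pdf_cov g i i.
  have e0 : delta_mx ord0 i != 0 :> 'rV[R]_n.
    by apply/rV0Pn; exists i; rewrite mxE !eqxx oner_eq0.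
  by have := Kpos _ e0; rewrite -rowE trmx_delta -colE !mxE.
rewrite /mxtrace (bigD1 (Ordinal n0))//= ltr_pwDl//.
by apply: sumr_ge0 => i _; exact: ltW.
Qed.

(** Among scalar matrices [K = s I], the Gaussian bound is smallest at [s = t / n]. The trace term
    is then [n], which becomes the factor [e] inside the logarithm. *)
Lemma Ent_pdf_trace_bound : (0 < n)%N ->
  (- Ent mu g <=
   (n%:R / 2 * ln (2 * pi * expR 1 / n%:R * \tr (pdf_cov g)))%:E)%E.
Proof.
move=> n0; have t0 := pdf_cov_trace_gt0 n0; set t := \tr _ in t0 *.
have nR0 : 0 < n%:R :> R by rewrite ltr0n.
have pi20 : 0 < 2 * pi :> R by rewrite mulr_gt0// pi_gt0.
have s0 : 0 < t / n%:R by rewrite divr_gt0.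
have := Ent_pdf_gaussian_bound (posdef_scalar n s0).
rewrite det_scalar invmx_scalar mul_scalar_mx mxtraceZ -/t => /le_trans; apply.
rewrite lee_fin le_eqVlt; apply/orP; left; apply/eqP.
rewrite (_ : 2 * pi * expR 1 / n%:R * t = 2 * pi * (expR 1 * (t / n%:R))); last first.
  by field; rewrite gt_eqF.
have -> : ln (2 * pi * (expR 1 * (t / n%:R))) = ln (2 * pi) + (1 + ln (t / n%:R)).
  rewrite [LHS]lnM ?posrE ?(mulr_gt0 (expR_gt0 _))//.
  by rewrite [in LHS](lnM _ s0) ?posrE ?expR_gt0// expRK.
rewrite lnXn//.
by rewrite -[_ *+ n]mulr_natl; field; rewrite !gt_eqF.
Qed.

Lemma Ent_pdf_det_bound :
  (- Ent mu g <= ((n%:R * ln (2 * pi) + ln (\det (pdf_cov g)) + n%:R) / 2)%:E)%E.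
Proof.
have Kpd := posdef_pdf_cov.
have := Ent_pdf_gaussian_bound Kpd.
by rewrite mulVmx ?mxtrace1// posdef_unitmx.
Qed.

End second_moments.

(** * Transfer from random vectors to their densities *)

Section random_vector_density.
Context {R : realType} {n : nat} {d : measure_display} {T : measurableType d}.
Variables (P : probability T R) (X : {RV P >-> 'rV[R]_n}) (g : 'rV[R]_n -> R).
Hypothesis Xg : has_pdf X g.

Let mg : measurable_fun setT g. Proof. by have [[]] := Xg. Qed.
Let g0 x : 0 <= g x. Proof. by have [[]] := Xg. Qed.

(** Both sides equal the integral of [phi] against the law of [X]; positive and negative parts are
    treated separately, which covers infinite integrals. *)
Lemma integral_has_pdf (phi : 'rV[R]_n -> R) : measurable_fun setT phi ->
  (\int[P]_t (phi (X t))%:E = \int[lebesgue_rV n]_x (phi x * g x)%:E)%E.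
Proof.
move=> mphi; have [_ XE] := Xg.
rewrite -(integral_density (nu := distribution P X) mg g0 XE mphi).
rewrite [LHS]integralE [RHS]integralE !ge0_integral_distribution//; last 2 first.
- by apply: measurable_funeneg; exact/measurable_EFinP.
- by apply: measurable_funepos; exact/measurable_EFinP.
by congr (_ - _)%E; apply: eq_integral => t _; rewrite /= ?funeposE ?funenegE.
Qed.

Lemma has_pdf_finite_second_moments :
  finite_second_moments X -> pdf_finite_second_moments g.
Proof.
move=> X2 i; have /integrableP[_] := X2 i.
have m2 : measurable_fun setT (fun x : 'rV[R]_n => x ord0 i ^+ 2).
  by apply: measurable_funX; exact: measurable_coord.
move=> X2i; apply/integrableP; split.
  by apply/measurable_EFinP; exact: measurable_funM.
rewrite (eq_integral (fun x : 'rV[R]_n => (x ord0 i ^+ 2 * g x)%:E)); last first.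
  by move=> x _ /=; rewrite ger0_norm// mulr_ge0// sqr_ge0.
have /= <- := integral_has_pdf m2.
rewrite (eq_integral (fun t => `|(X t ord0 i ^+ 2)%:E|%E))//.
by move=> t _ /=; rewrite ger0_norm ?sqr_ge0.
Qed.

Lemma cov_pdf : cov X = pdf_cov g.
Proof.
have EX i : fine 'E_P[(fun t => X t ord0 i)] = pdf_mean g ord0 i.
  rewrite mxE expectation.unlock; congr fine.
  exact: (integral_has_pdf (measurable_coord i)).
apply/matrixP => i j; rewrite [LHS]mxE covariance.unlock !EX.
rewrite expectation.unlock [RHS]mxE; congr fine.
apply: (integral_has_pdf
  (phi := fun x => (x ord0 i - pdf_mean g ord0 i) * (x ord0 j - pdf_mean g ord0 j))).
by apply: measurable_funM; apply: measurable_funB => //; exact: measurable_coord.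
Qed.

End random_vector_density.

(** The entropy is defined through a chosen density, possibly different from the smooth one at hand;
    the preceding bounds are applied to the chosen one. *)
Lemma has_pdf_pdf_of (R : realType) (n : nat) (d : measure_display)
    (T : measurableType d) (P : probability T R) (X : {RV P >-> 'rV[R]_n}) :
  (exists f, has_pdf X f) -> has_pdf X (pdf_of X).
Proof. by move=> [f Xf]; exact: (xgetI (cst 0) Xf). Qed.

(** Monotonicity of [expeR] on the extended reals, so that entropy [-oo] is included. *)
Lemma entropy_power_le (R : realType) (n : nat) (d : measure_display)
    (T : measurableType d) (P : probability T R) (X : {RV P >-> 'rV[R]_n})
    (b : R) : (0 < n)%N -> (shannon_entropy X <= b%:E)%E ->
  (entropy_power X <= ((2 * pi * expR 1)^-1 * expR (2 / n%:R * b))%:E)%E.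
Proof.
move=> n0 Hb; have nR0 : 0 < n%:R :> R by rewrite ltr0n.
have c0 : 0 < 2 * pi * expR 1 :> R by rewrite !mulr_gt0 ?pi_gt0 ?expR_gt0.
rewrite /entropy_power [leRHS]EFinM lee_pmul2l// ?lte_fin ?invr_gt0//.
rewrite -[(expR _)%:E]/(expeR (_)%:E) lee_expeR [leRHS]EFinM lee_pmul2l//.
by rewrite lte_fin divr_gt0.
Qed.

(** * Assertions (ii), (iii) and (iv) *)

Section assertions.
Variables (R : realType) (n : nat).
Hypothesis n0 : (0 < n)%N.

Let nR0 : 0 < n%:R :> R. Proof. by rewrite ltr0n. Qed.

Lemma assertion_ii_holds : assertion_ii R n.
Proof. by move=> g _ gpdf g2; exact: Ent_pdf_trace_bound. Qed.

Lemma assertion_iii_holds : assertion_iii R n.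
Proof.
move=> d T P X [f _ Xf] X2; have Xg := has_pdf_pdf_of (ex_intro _ _ Xf).
have [gpdf _] := Xg; have g2 := has_pdf_finite_second_moments Xg X2.
have t0 := pdf_cov_trace_gt0 gpdf g2 n0.
rewrite (cov_pdf Xg); set t := \tr _ in t0 *.
have c0 : 0 < 2 * pi * expR 1 :> R by rewrite !mulr_gt0 ?pi_gt0 ?expR_gt0.
have /(entropy_power_le n0) := Ent_pdf_trace_bound gpdf g2 n0.
(* The exponents cancel, so the exponential undoes the logarithm of the trace bound; positivity of
   the trace is what makes this legitimate. *)
rewrite -/t mulrA (_ : 2 / n%:R * (n%:R / 2) = 1); last by field; rewrite gt_eqF.
rewrite mul1r lnK; last by rewrite posrE mulr_gt0// divr_gt0.
set c := 2 * pi * expR 1 in c0 *.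
rewrite (_ : c^-1 * (c / n%:R * t) = t / n%:R); last first.
  by field; rewrite !gt_eqF.
rewrite -(@lee_pmul2l _ n%:R%:E)// ?lte_fin// -EFinM mulrC divfK//.
by rewrite gt_eqF.
Qed.

Lemma assertion_iv_holds : assertion_iv R n.
Proof.
move=> d T P X [f _ Xf] X2; have Xg := has_pdf_pdf_of (ex_intro _ _ Xf).
have [gpdf _] := Xg; have g2 := has_pdf_finite_second_moments Xg X2.
have [d0 _] := integral_gaussian_rV (posdef_pdf_cov gpdf g2).
rewrite (cov_pdf Xg); set D := \det _ in d0 *.
have p0 : 0 < 2 * pi :> R by rewrite mulr_gt0 ?pi_gt0.
have /(entropy_power_le n0) := Ent_pdf_det_bound gpdf g2.
rewrite -/D => /le_trans; apply; rewrite lee_fin /powR gt_eqF//.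
(* The first two terms cancel the normalisation [2 pi e]; the last one is the exponent of [D] to the
   power [1 / n]. *)
rewrite (_ : 2 / n%:R * _ = ln (2 * pi) + 1 + n%:R^-1 * ln D); last first.
  by field; rewrite gt_eqF.
rewrite !expRD lnK ?posrE// mulrA mulVf ?mul1r//.
by rewrite gt_eqF// mulr_gt0// expR_gt0.
Qed.

End assertions.

(** * Measurability of continuous functions, and derivatives along lines *)

Section continuous_rV.
Context {R : realType}.

(** The sigma-algebra comes from the coordinates and the topology from the sup norm; they meet
    because an open set is a countable union of boxes with rational corners. *)
Lemma open_measurable_rV n (O : set 'rV[R]_n) : open O -> measurable O.
Proof.
move=> oO.
pose box (ab : 'rV[rat]_n * 'rV[rat]_n) := [set y : 'rV[R]_n |
  forall i, ratr (ab.1 ord0 i) < y ord0 i < ratr (ab.2 ord0 i)].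
have mbox ab : measurable (box ab).
  have -> : box ab = \bigcap_(i in [set` (predT : pred 'I_n)])
      ((fun y : 'rV[R]_n => y ord0 i) @^-1`
       `]ratr (ab.1 ord0 i), ratr (ab.2 ord0 i)[%classic).
    apply/seteqP; split=> [y yab i _|y yab i] /=; first by rewrite in_itv/= yab.
    by have := yab i isT; rewrite /= in_itv.
  apply: fin_bigcap_measurable => [|i _]; first exact: finite_finpred.
  rewrite -[X in measurable X]setTI.
  by apply: (measurable_coord i) => //; exact: measurable_itv.
(* All rational boxes index the union; those not contained in [O] are replaced by the empty set. *)
have -> : O = \bigcup_ab (if `[< box ab `<=` O >] then box ab else set0).
  apply/seteqP; split=> [x Ox|x [ab _]]; last by case: asboolP => [bO /bO|_ []].
  have /nbhs_ballP[e/= e0 eO] : nbhs x O by exact: open_nbhs_nbhs.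
  have /choice[a aP] : forall i, exists q : rat, ratr q \in `]x ord0 i - e, x ord0 i[.
    by move=> i; apply: rat_in_itvoo; rewrite ltrBlDr ltrDl.
  have /choice[b bP] : forall i, exists q : rat, ratr q \in `]x ord0 i, x ord0 i + e[.
    by move=> i; apply: rat_in_itvoo; rewrite ltrDl.
  exists (\row_i a i, \row_i b i) => //=.
  case: asboolP => [_ i|[] y yab] /=.
    rewrite !mxE; move: (aP i) (bP i); rewrite !in_itv/=.
    by move=> /andP[_ ->] /andP[->].
  apply: eO; split => // i j; rewrite (ord1 i) /ball/= ltr_distlC.
  have := yab j; rewrite /= !mxE; move: (aP j) (bP j); rewrite !in_itv/=.
  move=> /andP[a1 a2] /andP[b1 b2] /andP[y1 y2].
  by rewrite (lt_trans a1 y1) (lt_trans y2 b2).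
apply: countable_bigcupT_measurable => [|ab]; first exact: countableP.
by case: asboolP.
Qed.

Lemma continuous_measurable_rV n (f : 'rV[R]_n -> R) :
  continuous f -> measurable_fun setT f.
Proof.
move=> cf; apply: (measurability _ (RGenOInfty.measurableE R)) => _ [_ [x ->] <-].
rewrite setTI; apply: open_measurable_rV.
apply: open_comp => [y _|]; first exact: cf.
by rewrite set_itvoy; exact: open_gt.
Qed.

Lemma line_continuous n (x e : 'rV[R]_n) : continuous (fun s : R => x + s *: e).
Proof.
move=> s; apply: (@cvgD _ 'rV[R]_n); first exact: cvg_cst.
by apply: (@cvgZr_tmp _ 'rV[R]_n).
Qed.

(** The two difference quotients are the same function, which gives access to one-variable
    calculus. *)
Lemma is_derive_line n (h : 'rV[R]_n -> R) (x e : 'rV[R]_n) (s df : R) :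
  is_derive (x + s *: e) e h df <-> is_derive s 1 (fun t => h (x + t *: e)) df.
Proof.
pose F t := h (x + t *: e).
have E : (fun t : R => t^-1 *: ((F \o shift s) (t *: 1) - F s)) =
    (fun t : R => t^-1 *: ((h \o shift (x + s *: e)) (t *: e) - h (x + s *: e))).
  apply/funext => t /=; congr (_ *: (h _ - _)).
  by rewrite /shift/= scalerDl -[t *: 1]/(t * 1) mulr1 addrCA.
have dE : derivable F s 1 = derivable h (x + s *: e) e by rewrite /derivable E.
have DE : 'D_1 F s = 'D_e h (x + s *: e) by rewrite /derive E.
split=> -[dh hE].
- by apply: (@DeriveDef _ _ _ _ _ F); [rewrite dE|rewrite DE].
- by apply: DeriveDef; [rewrite -dE|rewrite -DE].
Qed.

(** * Vanishing of the integral of a directional derivative *)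

Section derivative_integral.
Local Open Scope ereal_scope.
Variables (n : nat) (e : 'rV[R]_n) (h k : 'rV[R]_n -> R).
Hypotheses (dh : forall x, is_derive x e h (k x)) (ck : continuous k).
Hypotheses (ih : (lebesgue_rV n).-integrable setT (fun x => (h x)%:E)).
Hypotheses (ik : (lebesgue_rV n).-integrable setT (fun x => (k x)%:E)).
Local Notation mu := (lebesgue_rV n : {measure set 'rV[R]_n -> \bar R}).
Local Notation leb := (@lebesgue_measure R).

Lemma integral_derive_line (x : 'rV[R]_n) :
  \int[leb]_(s in `[0%R, 1%R]) (k (x + s *: e)%R)%:E = (h (x + e)%R - h x)%:E.
Proof.
pose F s := h (x + s *: e)%R.
have dF (s : R) : is_derive s 1%R F (k (x + s *: e)%R) by apply/is_derive_line.
have cF (s : R) : F z @[z --> s] --> F s.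
  by apply: differentiable_continuous; apply/derivable1_diffP; exact: ex_derive.
rewrite (@continuous_FTC2 R (fun s => k (x + s *: e)%R) F)//.
- by rewrite /F scale1r scale0r addr0.
- apply: continuous_subspaceT => s.
  by apply: continuous_comp; [exact: line_continuous|exact: ck].
- split=> [s _| |]; first exact: ex_derive.
  + exact: cvg_at_right_filter.
  + exact: cvg_at_left_filter.
- by move=> s _; rewrite derive1E; exact: derive_val.
Qed.

(* Translation invariance gives [\int (h (x + e) - h x) = 0], and the integrand
   is the average of [k] over the segment from [x] to [x + e]. *)
Lemma integral_derive_eq0 : \int[mu]_x (k x)%:E = 0.
Proof.
have mk : measurable_fun setT k := continuous_measurable_rV ck.
pose I01 (s : R) : R := \1_(`[0%R, 1%R]%classic : set R) s.
pose Phi (p : 'rV[R]_n * measurableTypeR R) := (k (p.1 + p.2 *: e)%R * I01 p.2)%:E.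
have mPhi : measurable_fun setT Phi.
  apply/measurable_EFinP; apply: measurable_funM; last first.
    apply: (measurableT_comp (f := I01)); last exact: measurable_snd.
    by apply: measurable_indic; exact: measurable_itv.
  apply: (measurableT_comp mk); apply: measurable_fun_rVP => i.
  rewrite (_ : (fun _ => _) = (fun p : 'rV[R]_n * measurableTypeR R =>
    p.1 ord0 i + p.2 * e ord0 i)%R); last by apply/funext => p; rewrite !mxE.
  apply: measurable_funD; last first.
    by apply: measurable_funM => //; exact: measurable_snd.
  by apply: (measurableT_comp (measurable_coord i)); exact: measurable_fst.
have leb01 : leb `[0%R, 1%R]%classic = 1.
  by rewrite lebesgue_measure_itv/= lte_fin ltr01 -EFinB subr0.
have int01 (c : \bar R) : 0 <= c -> \int[leb]_s (c * (I01 s)%:E) = c.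
  move=> c0; rewrite ge0_integralZl//.
  - rewrite integral_indic// setIT -[RHS]mule1; congr (_ * _).
    exact: leb01.
  - by apply/measurable_EFinP/measurable_indic; exact: measurable_itv.
  - by move=> s _; rewrite lee_fin /I01 indicE.
(* For fixed [s], translation invariance makes the integral of [|Phi|] over [x] equal to that of
   [|k|] times the indicator, so the double integral is that of [|k|]. *)
have iPhi : (lebesgue_rV n \x leb).-integrable setT Phi.
  apply/integrable21ltyP => //.
  have /integrableP[_] := ik; rewrite -[X in X < _]int01 ?integral_ge0//.
  congr (_ < _); apply: eq_integral => s _.
  rewrite -(ge0_integral_translate_rV (s *: e)%R (f := fun x => `|(k x)%:E|))//;
    last by apply: measurableT_comp => //; exact/measurable_EFinP.
  rewrite -ge0_integralZr//.
  - apply: eq_integral => x _ /=.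
    by rewrite normrM [`|I01 s|%R]ger0_norm// /I01 indicE.
  - apply: measurableT_comp => //; apply/measurable_EFinP.
    by apply: (measurableT_comp mk); exact: measurable_translate_rV.
  - by rewrite lee_fin /I01 indicE.
have : \int[mu]_x \int[leb]_s Phi (x, s) = 0.
  transitivity (\int[mu]_x ((h (x + e)%R)%:E - (h x)%:E)).
    apply: eq_integral => x _; rewrite -EFinB -integral_derive_line.
    rewrite [RHS]integral_mkcond; apply: eq_integral => s _.
    rewrite /Phi/= patchE /I01 indicE; case: ifPn => _; by rewrite ?mulr1 ?mulr0.
  rewrite integralB//; last exact: integrable_translate_rV.
  rewrite integral_translate_rV; last exact: measurable_integrableR ih.
  by rewrite subee//; exact: integrable_fin_num.
(* After the exchange, each inner integral is that of [k], by translation; averaging over the unit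
   interval leaves it unchanged. *)
rewrite (Fubini iPhi); move=> <-.
have kfin := integrable_fin_num measurableT ik.
transitivity (\int[leb]_s ((\int[mu]_x k x)%R * I01 s)%:E).
  rewrite -[LHS]fineK// -[fine _]/((\int[mu]_x k x)%R).
  have i01 : leb.-integrable setT (fun s => (I01 s)%:E).
    exact: integrable_indic_itv.
  rewrite (@integralZl _ _ _ leb setT measurableT (fun s => (I01 s)%:E) i01).
  rewrite (_ : \int[leb]_s (I01 s)%:E = 1) ?mule1//.
  by rewrite -[RHS](int01 1 lee01); apply: eq_integral => s _; rewrite mul1e.
apply: eq_integral => s _; rewrite /Phi/= EFinM EFin_Rintegral//.
rewrite -(integral_translate_rV (s *: e)%R mk) -integralZr//.
exact: (integrable_translate_rV _ ik).
Qed.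

End derivative_integral.
End continuous_rV.

(** * The standard Gaussian measure and its density *)

Section gaussian_measure.
Context {R : realType} {n : nat}.
Local Notation phi := (@gauss_pdf_rV R n).
Local Notation gam := (gauss_rV n : {measure set 'rV[R]_n -> \bar R}).
Local Notation mu := (lebesgue_rV n : {measure set 'rV[R]_n -> \bar R}).
Implicit Types (f g : 'rV[R]_n -> R) (a x : 'rV[R]_n).

Definition dot_rV a x : R := \sum_i a ord0 i * x ord0 i.

Lemma enorm_sqr x : enorm x ^+ 2 = dot_rV x x.
Proof.
rewrite sqr_sqrtr; last by apply: sumr_ge0 => i _; exact: sqr_ge0.
by apply: eq_bigr => i _; rewrite expr2.
Qed.

Lemma dot_rVB a x : dot_rV (x - a) (x - a) = dot_rV x x - dot_rV a x *+ 2 + dot_rV a a.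
Proof.
rewrite -sumrMnl -sumrB -big_split; apply: eq_bigr => i _ /=.
by rewrite !mxE mulr2n; ring.
Qed.

Lemma measurable_dot a : measurable_fun setT (dot_rV a).
Proof. exact: measurable_dot_rV. Qed.

(** Completing the square: exponential tilting of the Gaussian density is a translation. It yields
    both the exponential integrals and the derivative of the density. *)
Lemma gauss_pdf_shift a x :
  expR (dot_rV a x - dot_rV a a / 2) * phi x = phi (x - a).
Proof.
rewrite /gauss_pdf_rV mulrCA -expRD !enorm_sqr dot_rVB mulr2n.
by congr (_ * expR _); field.
Qed.

Lemma integral_gauss_pdf : (\int[mu]_x (phi x)%:E = 1)%E.
Proof.
have pi20 : 0 < 2 * pi :> R by rewrite mulr_gt0// pi_gt0.
have [_] := integral_gaussian_rV (posdef_scalar n (@ltr01 R)).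
rewrite det1 mulr1 invmx1 => I.
rewrite /gauss_pdf_rV.
transitivity (\int[mu]_x (((2 * pi) `^ (- (n%:R / 2)))%:E *
    (expR (- (x *m 1%:M *m x^T) ord0 ord0 / 2))%:E))%E.
  apply: eq_integral => x _; rewrite -EFinM; congr (_ * expR _)%:E.
  rewrite enorm_sqr mulmx1 mulNr; congr (- (_ / _)).
  by rewrite mxE; apply: eq_bigr => i _; rewrite mxE.
rewrite ge0_integralZl//; last 2 first.
- apply/measurable_EFinP; apply: measurableT_comp => //.
  by apply: measurable_funM => //; apply: measurableT_comp => //;
    exact: measurable_quad_form.
- by rewrite lee_fin powR_ge0.
rewrite I -EFinM; congr EFin.
rewrite -powR12_sqrt ?exprn_ge0 ?ltW// -powR_mulrn ?ltW// -powRrM -powRD.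
  by rewrite addNr powRr0.
by apply/implyP => _; rewrite gt_eqF.
Qed.

Lemma gauss_rVE (A : set 'rV[R]_n) : measurable A ->
  gam A = (\int[mu]_(x in A) (phi x)%:E)%E.
Proof. by []. Qed.

Lemma integral_gauss f : measurable_fun setT f ->
  (\int[gam]_x (f x)%:E = \int[mu]_x (f x * phi x)%:E)%E.
Proof.
exact: (integral_density (@measurable_gauss_pdf_rV R n) (@gauss_pdf_rV_ge0 R n)
  gauss_rVE).
Qed.

Lemma integrable_gauss f : measurable_fun setT f ->
  gam.-integrable setT (fun x => (f x)%:E) <->
  mu.-integrable setT (fun x => (f x * phi x)%:E).
Proof.
exact: (integrable_density (@measurable_gauss_pdf_rV R n) (@gauss_pdf_rV_ge0 R n)
  gauss_rVE).
Qed.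

Lemma integral_gauss_exp a :
  (\int[gam]_x (expR (dot_rV a x - dot_rV a a / 2))%:E = 1)%E.
Proof.
rewrite integral_gauss; last first.
  apply: measurableT_comp => //; apply: measurable_funB => //.
  exact: measurable_dot.
under eq_integral do rewrite gauss_pdf_shift.
by rewrite (integral_translate_rV (- a) (@measurable_gauss_pdf_rV R n))
  integral_gauss_pdf.
Qed.

Lemma integrable_gauss_exp a :
  gam.-integrable setT (fun x => (expR (dot_rV a x - dot_rV a a / 2))%:E).
Proof.
apply/integrableP; split.
  apply/measurable_EFinP; apply: measurableT_comp => //.
  by apply: measurable_funB => //; exact: measurable_dot.
under eq_integral do rewrite /= ger0_norm ?expR_ge0//.
by rewrite integral_gauss_exp ltry.
Qed.

Lemma continuous_addR f g : continuous f -> continuous g ->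
  continuous (fun x => f x + g x).
Proof. by move=> cf cg x; exact: (@continuousD _ R^o _ _ _ x (cf x) (cg x)). Qed.

Lemma continuous_mulR f g : continuous f -> continuous g ->
  continuous (fun x => f x * g x).
Proof. by move=> cf cg x; exact: (continuousM (cf x) (cg x)). Qed.

Lemma continuous_sumR (I : Type) (s : seq I) (F : I -> 'rV[R]_n -> R) :
  (forall i, continuous (F i)) -> continuous (fun x => \sum_(i <- s) F i x).
Proof.
move=> cF; elim: s => [|i s IH].
  have -> : (fun x => \sum_(i <- [::]) F i x) = cst 0.
    by apply/funext => x; rewrite big_nil.
  exact: cst_continuous.
have -> : (fun x => \sum_(j <- i :: s) F j x) =
    (fun x => F i x + \sum_(j <- s) F j x).
  by apply/funext => x; rewrite big_cons.
exact: continuous_addR.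
Qed.

Lemma continuous_gauss_pdf : continuous phi.
Proof.
have -> : phi = fun x => (2 * pi) `^ (- (n%:R / 2)) *
    (expR \o (fun x => (- 2^-1) * \sum_i x ord0 i * x ord0 i)) x.
  apply/funext => x; rewrite /gauss_pdf_rV enorm_sqr /=.
  by congr (_ * expR _); rewrite mulrC mulNr.
apply: continuous_mulR; first exact: cst_continuous.
move=> x; apply: continuous_comp; last exact: continuous_expR.
apply: continuous_mulR; first exact: cst_continuous.
apply: continuous_sumR => i.
by apply: continuous_mulR; exact: coord_continuous.
Qed.

Lemma dot_rV_delta i x : dot_rV (delta_mx ord0 i) x = x ord0 i.
Proof.
rewrite /dot_rV (bigD1 i)//= mxE !eqxx mul1r big1 ?addr0// => j ji.
by rewrite mxE (negbTE ji) andbF mul0r.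
Qed.

Lemma is_derive_gauss_pdf i x :
  is_derive x (delta_mx ord0 i) phi (- x ord0 i * phi x).
Proof.
set e : 'rV[R]_n := delta_mx ord0 i; set xi := x ord0 i.
(* By the shift formula with [a = - t e], the density along the line is [phi x] times the
   exponential of this quadratic. *)
pose p : R -> R := - ((cst xi : R -> R) * id + cst 2^-1 * (id ^+ 2)).
have lineE : (fun t : R => phi (x + t *: e)) = cst (phi x) * (expR \o p).
  apply/funext => t; have dZ (s : R) a y : dot_rV (s *: a) y = s * dot_rV a y.
    by rewrite /dot_rV mulr_sumr; apply: eq_bigr => j _; rewrite mxE mulrA.
  have -> : x + t *: e = x - (- t) *: e by rewrite scaleNr opprK.
  rewrite -gauss_pdf_shift !dZ !dot_rV_delta mxE mxE !eqxx mulrC.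
  rewrite /p !fctE /=; congr (_ * expR _).
  by rewrite -/xi mulr1; field.
have dp : is_derive (0 : R) 1 p (- xi).
  have d1 : is_derive (0 : R) 1 (id : R -> R) 1 by exact: is_derive_id.
  have dx : is_derive (0 : R) 1 (cst xi * id : R -> R) (xi *: 1 + 0 *: 0).
    exact: (is_deriveM (is_derive_cst xi _ _) d1).
  have d2 := is_deriveX 2 d1.
  have dh := is_deriveM (is_derive_cst (2^-1 : R) (0 : R) 1) d2.
  apply: is_derive_eq (is_deriveN (is_deriveD dx dh)) _.
  by rewrite /GRing.scale/= !fctE; ring.
have de : is_derive (0 : R) 1 (expR \o p) (- xi).
  have p0 : p 0 = 0 by rewrite /p !fctE /=; ring.
  apply: is_derive_eq (is_derive1_comp (is_derive_expR (p 0)) dp) _.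
  by rewrite p0 expR0 mul1r.
have : is_derive (0 : R) 1 (fun t : R => phi (x + t *: e)) (- xi * phi x).
  rewrite lineE.
  apply: is_derive_eq (is_deriveM (is_derive_cst (phi x) _ _) de) _.
  by rewrite /GRing.scale/= mulr0 addr0 mulrC.
by move/is_derive_line; rewrite scale0r addr0.
Qed.

End gaussian_measure.

(** * Gaussian integration by parts, the entropy bound and assertion (i) *)

Section gaussian_entropy.
Context {R : realType} {n : nat}.
Local Notation phi := (@gauss_pdf_rV R n).
Local Notation gam := (gauss_rV n : {measure set 'rV[R]_n -> \bar R}).
Local Notation mu := (lebesgue_rV n : {measure set 'rV[R]_n -> \bar R}).
Local Notation integrableR f := (gam.-integrable setT (fun x => (f x)%:E)).
Implicit Types (f : 'rV[R]_n -> R) (a x : 'rV[R]_n).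

(** The derivative of [f * phi] along coordinate [i] is [k], the difference of the two integrands
    times [phi], and its Lebesgue integral vanishes. *)
Lemma gauss_integration_by_parts f i :
  continuous f -> continuous (partial i f) ->
  (forall x, derivable f x (delta_mx ord0 i)) ->
  integrableR f -> integrableR (partial i f) ->
  integrableR (fun x => x ord0 i * f x) ->
  (\int[gam]_x partial i f x = \int[gam]_x (x ord0 i * f x))%R.
Proof.
move=> cf cdf df if_ idf ixf.
pose k x := (partial i f x + (-1) * (x ord0 i * f x)) * phi x.
have mf := continuous_measurable_rV cf.
have mxf : measurable_fun setT (fun x => x ord0 i * f x).
  exact: measurable_integrableR ixf.
have mdf := continuous_measurable_rV cdf.
have dh x : is_derive x (delta_mx ord0 i) (f * phi) (k x).
  apply: is_derive_eq (is_deriveM (derivableP (df x)) (is_derive_gauss_pdf i x)) _.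
  by rewrite /k /GRing.scale/= /partial; ring.
have ck : continuous k.
  apply: continuous_mulR; last exact: continuous_gauss_pdf.
  apply: continuous_addR => //; apply: continuous_mulR; first exact: cst_continuous.
  by apply: continuous_mulR => //; exact: coord_continuous.
have ig : integrableR (fun x => partial i f x + (-1) * (x ord0 i * f x)).
  by apply: integrableRD => //; exact: integrableRZl.
have mgk := measurable_integrableR ig.
have ik : mu.-integrable setT (fun x => (k x)%:E) by exact/integrable_gauss.
have ih : mu.-integrable setT (fun x => ((f * phi) x)%:E).
  exact/integrable_gauss.
have := integral_derive_eq0 dh ck ih ik.
rewrite -(integral_gauss mgk) -EFin_Rintegral// => -[].
rewrite RintegralD//; last exact: integrableRZl.
by rewrite RintegralZl// mulN1r => /eqP; rewrite subr_eq0 => /eqP.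
Qed.

(* Young's inequality [t y <= y ln y - y + exp t] for [t] and [- t]. *)
Lemma integrable_gauss_coordM f i : (forall x, 0 <= f x) ->
  measurable_fun setT f -> integrableR (fun x => f x * ln (f x)) ->
  integrableR (fun x => x ord0 i * f x).
Proof.
move=> f0 mf ifl.
pose e : 'rV[R]_n := delta_mx ord0 i; pose c := dot_rV e e / 2.
have iexp a : dot_rV a a = dot_rV e e -> integrableR (fun x => expR (dot_rV a x)).
  move=> ae; have := integrableRZl (expR c) (integrable_gauss_exp a).
  apply: eq_integrable => // x _; rewrite -expRD ae -/c.
  by congr (expR _)%:E; rewrite addrC subrK.
have dotN x : dot_rV (- e) x = - dot_rV e x.
  by rewrite /dot_rV -sumrN; apply: eq_bigr => j _; rewrite mxE mulNr.
have eNe : dot_rV (- e) (- e) = dot_rV e e.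
  by apply: eq_bigr => j _; rewrite mxE mulrNN.
(* The dominating function is [|f ln f| + exp x_i + exp (- x_i)]. *)
have := integrableRD (integrableRD (integrable_norm ifl) (iexp e erefl))
  (iexp (- e) eNe).
apply: le_integrableR => [|x /=].
  by apply: measurable_funM => //; exact: measurable_coord.
rewrite dotN dot_rV_delta; set t := x ord0 i.
have := gibbs_pointwise (f0 x) (expR_gt0 t).
have := gibbs_pointwise (f0 x) (expR_gt0 (- t)).
rewrite !expRK ler_norml.
have := f0 x; have := ler_norm (f x * ln (f x)).
have := expR_gt0 t; have := expR_gt0 (- t).
by move=> *; apply/andP; split; nra.
Qed.

Lemma gauss_entropy_bound f (a : 'rV[R]_n) : (forall x, 0 <= f x) ->
  integrableR f -> (forall i, integrableR (fun x => x ord0 i * f x)) ->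
  integrableR (fun x => f x * ln (f x)) ->
  let m := (\int[gam]_x f x)%R in
  0 < m ->
  m * ln m + \sum_i a ord0 i * (\int[gam]_x (x ord0 i * f x))%R
    - m * (dot_rV a a / 2) <= (\int[gam]_x (f x * ln (f x)))%R.
Proof.
move=> f0 if_ ixf ifl m m0.
pose E x := expR (dot_rV a x - dot_rV a a / 2).
have iE : integrableR E by exact: integrable_gauss_exp.
have E1 : (\int[gam]_x E x)%R = 1 by rewrite /Rintegral integral_gauss_exp.
pose l x := \sum_i a ord0 i * (x ord0 i * f x).
have il : integrableR l by apply: integrableR_sum => i; exact: integrableRZl.
have lE x : l x = dot_rV a x * f x.
  by rewrite /l /dot_rV mulr_suml; apply: eq_bigr => i _; rewrite mulrA.
(* The constant coefficient of [f] in Gibbs' inequality against [m E], which has the same mass as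
   [f]. *)
pose d := ln m - dot_rV a a / 2 + 1.
have iA : integrableR (fun x => l x + d * f x).
  by apply: integrableRD => //; exact: integrableRZl.
have ih : integrableR (fun x => l x + d * f x - m * E x).
  by apply: integrableRB => //; exact: integrableRZl.
have hle x : l x + d * f x - m * E x <= f x * ln (f x).
  have b0 : 0 < m * E x by rewrite mulr_gt0 ?expR_gt0.
  apply: le_trans (gibbs_pointwise (f0 x) b0).
  rewrite lnM ?posrE ?expR_gt0// expRK lE /d.
  by rewrite le_eqVlt; apply/orP; left; apply/eqP; field.
have := le_Rintegral measurableT ih ifl (fun x _ => hle x).
rewrite RintegralB//; last exact: integrableRZl.
rewrite RintegralD//; last exact: integrableRZl.
rewrite !RintegralZl// E1 -/m Rintegral_sum => [|i]; last exact: integrableRZl.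
rewrite (eq_bigr (fun i => a ord0 i * (\int[gam]_x (x ord0 i * f x))%R)); last first.
  by move=> i _; rewrite RintegralZl//; exact: ixf.
by apply: le_trans; rewrite le_eqVlt; apply/orP; left; apply/eqP; rewrite /d; field.
Qed.

Lemma gauss_mean_bound f : (forall x, 0 <= f x) ->
  integrableR f -> (forall i, integrableR (fun x => x ord0 i * f x)) ->
  integrableR (fun x => f x * ln (f x)) ->
  let m := (\int[gam]_x f x)%R in
  0 < m ->
  \sum_i (\int[gam]_x (x ord0 i * f x))%R ^+ 2 <=
  2 * ((\int[gam]_x (f x * ln (f x)))%R - m * ln m) * m.
Proof.
move=> f0 if_ ixf ifl m m0.
pose v i : R := (\int[gam]_x (x ord0 i * f x))%R.
pose S := \sum_i v i ^+ 2.
(* This vector maximises [a . v - m |a|^2 / 2], with value [S / (2 m)]. *)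
have := gauss_entropy_bound (\row_i (v i / m)) f0 if_ ixf ifl m0.
rewrite -/m (eq_bigr (fun i => m^-1 * v i ^+ 2)); last first.
  by move=> i _; rewrite mxE -/(v i) expr2 mulrCA mulrA.
rewrite -mulr_sumr -/S.
have -> : dot_rV (\row_i (v i / m)) (\row_i (v i / m)) = S / m ^+ 2.
  rewrite /dot_rV /S mulr_suml; apply: eq_bigr => i _.
  by rewrite !mxE expr2 mulrACA -invfM -!expr2.
move=> H; rewrite -subr_ge0; move: H; rewrite -subr_ge0.
set A := (\int[gam]_x _)%R => H.
have -> : 2 * (A - m * ln m) * m - S =
    2 * m * (A - (m * ln m + m^-1 * S - m * (S / m ^+ 2 / 2))).
  by field; rewrite gt_eqF.
by rewrite mulr_ge0// mulr_ge0// ltW.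
Qed.

(** Three cases: zero mass, finite entropy, infinite entropy. In the first two, integrability of
    [f ln f] yields the first moments and hence integration by parts. *)
Lemma assertion_i_holds : assertion_i R n.
Proof.
move=> f sf f0 if_ igf.
have cf : continuous f by have [] := sf [::].
have df i x : derivable f x (delta_mx ord0 i) by have [_] := sf [::]; exact.
have cdf i : continuous (partial i f) by have [] := sf [:: i].
have mf := continuous_measurable_rV cf.
have mfl : measurable_fun setT (fun x => f x * ln (f x)).
  by apply: measurable_funM => //; exact: measurableT_comp.
have idf i : integrableR (partial i f).
  apply: (le_integrableR _ _ igf) => [|x].
    exact: (continuous_measurable_rV (cdf i)).
  rewrite -sqrtr_sqr ler_wsqrtr// (bigD1 i)//= mxE lerDl.
  by apply: sumr_ge0 => j _; exact: sqr_ge0.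
pose m := (\int[gam]_x f x)%R.
have mE : (\int[gam]_x (f x)%:E = m%:E)%E by rewrite -EFin_Rintegral.
have m0 : 0 <= m by apply: Rintegral_ge0.
have gE : (\row_i (\int[gam]_x gradient f x ord0 i)%R) =
    \row_i (\int[gam]_x partial i f x)%R.
  apply/rowP => i; rewrite !mxE; apply: eq_Rintegral => x _; by rewrite mxE.
rewrite gE mE enorm_sqr /dot_rV.
under eq_bigr do rewrite !mxE -expr2.
have parts : integrableR (fun x => f x * ln (f x)) ->
    (forall i, integrableR (fun x => x ord0 i * f x)) /\
    forall i, (\int[gam]_x partial i f x = \int[gam]_x (x ord0 i * f x))%R.
  move=> ifl; have ixf i := integrable_gauss_coordM i f0 mf ifl.
  by split=> // i; exact: gauss_integration_by_parts.
move: m0; rewrite le_eqVlt => /predU1P[m0|m0].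
  (* With zero mass [f] vanishes almost everywhere, so integration by parts makes the left side zero
     as well. *)
  have f_ae : ae_eq gam setT (fun x => (f x)%:E) (cst 0%E).
    apply/ae_eq_integral_abs => //; first exact/measurable_EFinP.
    by under eq_integral do rewrite /= ger0_norm//; rewrite mE -m0.
  have ifl : integrableR (fun x => f x * ln (f x)).
    apply/integrableP; split; first exact/measurable_EFinP.
    suff -> : (\int[gam]_x `|(f x * ln (f x))%:E| = 0)%E by rewrite ltry.
    apply/ae_eq_integral_abs => //; first exact/measurable_EFinP.
    by apply: filterS f_ae => x /= + _ => /(_ Logic.I)[->]; rewrite mul0r.
  have [ixf dE] := parts ifl.
  rewrite -m0 mule0 lee_fin big1// => i _; rewrite dE /Rintegral.
  rewrite (ae_eq_integral (cst 0%E))//.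
  - by rewrite integral0 expr0n.
  - exact: measurable_int (ixf i).
  - by apply: filterS f_ae => x /= + _ => /(_ Logic.I)[->]; rewrite mulr0.
have [lfin|linf] := boolP ((\int[gam]_x (f x * ln (f x))%:E)%E \is a fin_num).
  have ifl : integrableR (fun x => f x * ln (f x)).
    apply/integrableP; split; first exact/measurable_EFinP.
    by rewrite integral_fin_num_abs.
  have [ixf dE] := parts ifl.
  under eq_bigr do rewrite dE.
  rewrite /Ent -EFin_Rintegral// -EFinB.
  by have := gauss_mean_bound f0 if_ ixf ifl m0; rewrite -lee_fin.
(* Comparison with the constant 1 gives [f - 1 <= f ln f], so a non-finite integral is [+oo] and, as
   [m > 0], so is the right side. Integrability of 1 is the case [a = 0] of the exponentials. *)
have i1 : integrableR (fun x => f x - 1).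
  apply: integrableRB => //.
  have := integrable_gauss_exp (0 : 'rV[R]_n); apply: eq_integrable => // x _.
  rewrite /dot_rV !big1 ?mul0r ?subrr ?expR0// => j _; by rewrite mxE mul0r.
have lb := le_integral_integrable_l i1 mfl _.
have {}lb : ((\int[gam]_x (f x - 1))%R%:E <= \int[gam]_x (f x * ln (f x))%:E)%E.
  rewrite EFin_Rintegral//; apply: lb => x.
  by have := gibbs_pointwise (f0 x) ltr01; rewrite ln1 mulr0 add0r.
have ly : (\int[gam]_x (f x * ln (f x))%:E = +oo)%E.
  by move: lb linf; case: (\int[gam]_x _)%E.
by rewrite /Ent ly -/m addye// gt0_muley// ?lte_fin// gt0_mulye ?lte_fin// leey.
Qed.

End gaussian_entropy.

Theorem theorem1 (R : realType) (n : nat) (n_gt0 : (0 < n)%N) :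
  [/\ assertion_i R n, assertion_ii R n, assertion_iii R n & assertion_iv R n] /\
  [<-> assertion_i R n; assertion_ii R n; assertion_iii R n; assertion_iv R n].
Proof.
have Hi := @assertion_i_holds R n.
have Hii := @assertion_ii_holds R n n_gt0.
have Hiii := @assertion_iii_holds R n n_gt0.
have Hiv := @assertion_iv_holds R n n_gt0.
(* Each implication of the cycle follows from the truth of its conclusion. *)
by split; [split|tfae].
Qed.
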